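(* Let $n\ge3$ and $\ell\ge1$ be integers. There exist pairwise distinct non-zero integers $a_1,\dots,a_{n-1}$ such that the polynomial $$f(t,x)=(x-a_1)\cdots(x-a_{n-1})\left(x-(-1)^{n-1}\frac{t^\ell-1}{a_1\cdots a_{n-1}}\right)-1\in\mathbb Q[t,x]$$ has Galois group $\mathcal S_n$ (as a polynomial in $x$) over $\mathbb Q(t)$, and the polynomial $f(0,x)\in\mathbb Q[x]$ is separable. *)

(* Defs.v *)
From HB Require Import structures.
From mathcomp Require Import all_boot all_order all_algebra all_fingroup all_field.
Set Implicit Arguments. Unset Strict Implicit. Unset Printing Implicit Defensive.
Import GRing.Theory Num.Theory.
Local Open Scope ring_scope.

Definition Qt : fieldType := {fraction {poly rat}}.

Definition tvar : Qt := tofrac ('X : {poly rat}).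

(* "The Galois group of p over K is the full symmetric group on its roots":
   there is a splitting field L of p over K (generated over K by the roots rs
   of p, which are pairwise distinct and number deg p), and every permutation
   of the roots is induced by a K-automorphism of L, i.e. the image of
   Gal(L/K) in Sym(roots) is all of S_n with n = deg p. *)
Definition galois_group_is_Sn (K : fieldType) (p : {poly K}) : Prop :=
  exists (L : fieldExtType K) (rs : seq L),
    [/\ map_poly (in_alg L) p
          = (in_alg L (lead_coef p))%:P * \prod_(r <- rs) ('X - r%:P),
        uniq rs,
        size rs = (size p).-1,
        (<<1 & rs>>)%VS = fullv
      & forall s : 'S_(size rs),
          exists2 g : 'End(L), kAut 1%VS fullv g
            & forall i : 'I_(size rs), g (rs`_i) = rs`_(s i)].

Definition f_tx (n l : nat) (a : 'I_n.-1 -> int) : {poly Qt} :=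
  \prod_(i < n.-1) ('X - ((a i)%:~R : Qt)%:P)
    * ('X - ((-1) ^+ n.-1 * (tvar ^+ l - 1) / (\prod_(i < n.-1) a i)%:~R)%:P)
  - 1.

Definition f_0x (n l : nat) (a : 'I_n.-1 -> int) : {poly rat} :=
  \prod_(i < n.-1) ('X - ((a i)%:~R : rat)%:P)
    * ('X - ((-1) ^+ n.-1 * ((0 : rat) ^+ l - 1) / (\prod_(i < n.-1) a i)%:~R)%:P)
  - 1.

(* Main.v *)
Require Import Defs.
From HB Require Import structures.
From mathcomp Require Import all_boot all_order all_algebra all_fingroup all_field.
From mathcomp Require Import boolp.
From mathcomp Require classical_sets.
From mathcomp Require Import zify ring.
Import GRing.Theory Num.Theory.
Set Implicit Arguments. Unset Strict Implicit. Unset Printing Implicit Defensive.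
Local Open Scope ring_scope.

(* Write f = P (x - b) - 1 with P the product of the x - a_i. Fix a prime p not
   dividing l and extend to the splitting field L the p-adic Gauss valuation of
   Q(t) in the variable w = (t - 1) / p ^ e. If exactly k of the a_i are
   divisible by p, all of them exactly once, and the others are distinct modulo
   p, then for e = k - 1 the element p b is a unit. Exactly k roots of f then
   have valuation 1 / k, while the other n - k roots are fixed points of
   contractions defined over Q(t), hence lie in its completion. So the subgroup
   fixing these n - k roots is transitive on the k remaining ones.
   The a_i are chosen so that k = n - 1 occurs for a prime p and k = 2 for a
   prime q. As f has no root in Q(t), the first case makes the Galois group
   2-transitive, the second one gives a transposition, and together they
   generate S_n. A third prime with k = 1 shows that the roots of f(t, x) and
   of f(0, x) are distinct. *)

(** * Valuation rings *)

(** The exponent [e] comes from a count of valuations: since [t = 1 + p ^ e * w] and [p] is prime to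
    [l], [t ^ l - 1] has valuation [e], while the product of the [a_i] has valuation [k]; so [b] has
    valuation [-1] exactly for [e = k - 1]. Transitivity is a matter of ramification: nonzero
    elements of the completion of Q(t) have integral valuation, which rules out short orbits of
    roots of valuation [1 / k]. The valuation on [L] is given only by a subring [V] produced by
    Zorn's lemma, without a value group, and no completion is built. Valuations are compared through
    membership in [V] of quotients by powers of [pi], and lying in the completion means being
    approximable from the base field to every order. Finiteness of [L] over Q(t) supplies the
    archimedean property that the construction of [V] does not give. *)

Section Subring.
Variable L : fieldType.
Implicit Types (A V : L -> Prop) (x y z : L).

Record is_subring A : Prop := IsSubring {
  subring1 : A 1;
  subringB : forall x y, A x -> A y -> A (x - y);
  subringM : forall x y, A x -> A y -> A (x * y) }.

Section Closure.
Variables (A : L -> Prop) (sA : is_subring A).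

Lemma subring0 : A 0.
Proof. by rewrite -(subrr 1); apply: (subringB sA); apply: subring1. Qed.

Lemma subringN x : A x -> A (- x).
Proof. by move=> Ax; rewrite -sub0r; apply: (subringB sA) => //; apply: subring0. Qed.

Lemma subringD x y : A x -> A y -> A (x + y).
Proof. by move=> Ax Ay; rewrite -[y]opprK; apply: (subringB sA) => //; apply: subringN. Qed.

Lemma subringX x n : A x -> A (x ^+ n).
Proof.
move=> Ax; elim: n => [|n IH]; first by rewrite expr0; apply: subring1.
by rewrite exprS; apply: (subringM sA).
Qed.

Lemma subring_sum (I : Type) (r : seq I) (P : pred I) (F : I -> L) :
  (forall i, P i -> A (F i)) -> A (\sum_(i <- r | P i) F i).
Proof. by move=> AF; apply: big_ind => //; [apply: subring0|apply: subringD]. Qed.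

Lemma subring_prod (I : Type) (r : seq I) (P : pred I) (F : I -> L) :
  (forall i, P i -> A (F i)) -> A (\prod_(i <- r | P i) F i).
Proof. by move=> AF; apply: big_ind => //; [apply: subring1|apply: subringM]. Qed.

Lemma subring_nat n : A n%:R.
Proof.
elim: n => [|n IH]; first exact: subring0.
by rewrite -addn1 natrD; apply: subringD => //; apply: subring1.
Qed.

End Closure.

Record is_valuation_ring V : Prop := IsValuationRing {
  valuation_subring :> is_subring V;
  valuation_total : forall x, V x \/ V x^-1 }.

Definition adjoin A x : L -> Prop :=
  fun y => exists2 p : {poly L}, forall i, A p`_i & y = p.[x].

Lemma adjoin_subring A x : is_subring A -> is_subring (adjoin A x).
Proof.
move=> sA; split.
- exists 1; last by rewrite hornerC.
  by move=> i; rewrite coef1; apply: (subring_nat sA).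
- move=> y z [p Ap ->] [q Aq ->]; exists (p - q); last by rewrite !hornerE.
  by move=> i; rewrite coefB; apply: (subringB sA).
- move=> y z [p Ap ->] [q Aq ->]; exists (p * q); last by rewrite hornerM.
  by move=> i; rewrite coefM; apply: (subring_sum sA) => j _; apply: (subringM sA).
Qed.

Lemma sub_adjoin A x y : is_subring A -> A y -> adjoin A x y.
Proof.
move=> sA Ay; exists y%:P; last by rewrite hornerC.
by move=> i; rewrite coefC; case: eqP => // _; apply: subring0.
Qed.

Lemma mem_adjoin A x : is_subring A -> adjoin A x x.
Proof.
move=> sA; exists 'X; last by rewrite hornerX.
by move=> i; rewrite coefX; apply: (subring_nat sA).
Qed.

(** * Subrings maximal without the inverse of a given element *)

Section MaximalSubring.
Variables (A : L -> Prop) (pi : L).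
Hypotheses (sA : is_subring A) (Api : A pi) (A'pi : ~ A pi^-1).
Hypothesis maxA : forall x, ~ A x -> adjoin A x pi^-1.

Let pi_neq0 : pi != 0.
Proof. by apply/eqP => pi0; apply: A'pi; rewrite pi0 invr0; apply: (subring0 sA). Qed.

Let pi_unit c : A c -> pi * c != 1.
Proof.
move=> Ac; apply/eqP => pic; apply: A'pi; suff -> : pi^-1 = c by [].
by rewrite -[c](mulKf pi_neq0) pic mulr1.
Qed.

(** Otherwise maximality writes [pi^-1] as a polynomial in [e^-1], where [e = 1 - pi * c]. Clearing
    denominators makes a power of [e] a multiple of [pi]; it is also congruent to 1 modulo [pi], so
    [pi] would be invertible in [A]. *)
Lemma maximal_subring_inv1B c : A c -> A (1 - pi * c)^-1.
Proof.
move=> Ac; set e := 1 - pi * c; have Ae : A e.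
  by apply: (subringB sA); [apply: subring1|apply: (subringM sA)].
have e0 : e != 0 by rewrite subr_eq0 eq_sym pi_unit.
have [//|/maxA[p Ap piE]] := pselect (A e^-1); exfalso.
have [v Av eE] : exists2 v, A v & e ^+ size p = 1 + pi * v.
  elim: (size p) => [|d [v Av eE]].
    by exists 0; [apply: (subring0 sA)|rewrite mulr0 addr0].
  exists (- c * e ^+ d + v); last by rewrite exprS mulrBl mul1r {1}eE; ring.
  by apply: (subringD sA) => //; apply: (subringM sA); [apply: (subringN sA)|apply: (subringX sA)].
pose w := \sum_(i < size p) p`_i * e ^+ (size p - i).
have Aw : A w by apply: (subring_sum sA) => i _; apply: (subringM sA) => //; apply: (subringX sA).
have ew : e ^+ size p = pi * w.
  have : pi * p.[e^-1] = 1 by rewrite -piE mulfV.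
  move/(congr1 (fun z => z * e ^+ size p)); rewrite mul1r => <-.
  rewrite -mulrA horner_coef; congr (_ * _); rewrite mulr_suml; apply: eq_bigr => i _.
  rewrite -mulrA; congr (_ * _); rewrite exprVn; apply: canLR (mulKf _) _.
    by rewrite expf_neq0.
  by rewrite -exprD subnKC // ltnW.
have : pi * (w - v) != 1 by apply: pi_unit; apply: (subringB sA).
by rewrite mulrBr -ew eE addrK eqxx.
Qed.

(* With pi p(x) = pi q(1/x) = 1 and deg q <= deg p = m, the second relation
   rewrites x^m as a combination of lower powers of x. *)
Lemma maximal_subring_total x : A x \/ A x^-1.
Proof.
have [|A'x] := pselect (A x); first by left.
have [|A'x'] := pselect (A x^-1); [by right|exfalso].
have /maxA[p Ap /esym pE] := A'x; have /maxA[q Aq /esym qE] := A'x'.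
have x0 : x != 0 by apply/eqP => x0; apply: A'x; rewrite x0; apply: (subring0 sA).
have [N] := ubnP (size p + size q)%N.
elim: N x x0 p q Ap pE Aq qE {A'x A'x'} => // N IH x x0 p q Ap pE Aq qE leN.
wlog le_qp : x x0 p q Ap pE Aq qE leN / (size q <= size p)%N.
  move=> hw; case: (leqP (size q) (size p)) => [|/ltnW] le_qp; first exact: (hw x x0 p q).
  by apply: (hw x^-1 _ q p); rewrite ?invr_eq0 ?invrK // addnC.
have sq0 : (0 < size q)%N.
  rewrite lt0n; apply/eqP => /eqP; rewrite size_poly_eq0 => /eqP q0.
  by move: qE; rewrite q0 horner0 => /esym/eqP; rewrite invr_eq0 (negPf pi_neq0).
have [m sp] : exists m, size p = m.+1 by exists (size p).-1; rewrite prednK // (leq_trans sq0).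
have [k sq] : exists k, size q = k.+1 by exists (size q).-1; rewrite prednK.
rewrite sp sq ltnS in leN le_qp.
pose e := 1 - pi * q`_0; have Ae' : A e^-1 by apply: maximal_subring_inv1B.
have e0 : e != 0 by rewrite subr_eq0 eq_sym pi_unit.
have eE : e = pi * \sum_(j < k) q`_j.+1 * x^-1 ^+ j.+1.
  have : pi * q.[x^-1] = 1 by rewrite qE mulfV.
  by rewrite horner_coef sq big_ord_recl expr0 mulr1 mulrDr /e => <-; rewrite addrC addKr.
case: m sp le_qp leN => [|m] sp le_qp leN.
  apply: A'pi; rewrite -pE horner_coef sp big_ord1 expr0 mulr1; exact: Ap.
pose p1 : {poly L} := \sum_(i < m.+1) p`_i *: 'X^i
  + \sum_(j < k) (p`_m.+1 * e^-1 * pi * q`_j.+1) *: 'X^(m - j).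
apply: (IH x x0 p1 q) => //.
- move=> i; rewrite coefD !coef_sum; apply: (subringD sA); apply: (subring_sum sA) => j _;
    rewrite coefZ coefXn; apply: (subringM sA); rewrite //; try exact: (subring_nat sA).
  by do !apply: (subringM sA).
- rewrite /p1 hornerD !horner_sum -pE [RHS]horner_coef sp [RHS]big_ord_recr /=.
  congr (_ + _).
    by apply: eq_bigr => i _; rewrite hornerZ hornerXn.
  have -> : p`_m.+1 * x ^+ m.+1
      = p`_m.+1 * e^-1 * pi * \sum_(j < k) q`_j.+1 * (x^-1 ^+ j.+1 * x ^+ m.+1).
    under eq_bigr do rewrite mulrA.
    rewrite -mulr_suml -!mulrA [pi * _]mulrA -eE; congr (_ * _).
    by rewrite mulKf.
  rewrite mulr_sumr; apply: eq_bigr => j _; rewrite hornerZ hornerXn -!mulrA.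
  do 4!congr (_ * _); have jm : (j <= m)%N by rewrite -ltnS (leq_trans (ltn_ord j)) // ltnW.
  rewrite exprVn; apply: canRL (mulKf _) _; first by rewrite expf_neq0.
  by rewrite -exprD addSn subnKC.
- suff : (size p1 <= m.+1)%N by rewrite sq; lia.
  rewrite (leq_trans (size_polyD _ _)) // geq_max; apply/andP; split;
    apply: (leq_trans (size_sum _ _ _)); apply/bigmax_leqP => i _;
    apply: (leq_trans (size_scale_leq _ _)); rewrite size_polyXn //.
  by rewrite ltnS leq_subr.
Qed.

End MaximalSubring.

Import classical_sets.

(** Chevalley's extension argument with one element in place of a prime ideal: in a subring maximal
    among those containing [A] and omitting [pi^-1], adjoining anything new produces [pi^-1]. *)
Lemma valuation_ring_extension A pi : is_subring A -> A pi -> ~ A pi^-1 ->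
  exists V, [/\ is_valuation_ring V, forall x, A x -> V x & ~ V pi^-1].
Proof.
move=> sA Api A'pi.
(* The empty set is allowed because Zorn's lemma for unions also asks about the empty chain. *)
pose P (X : set L) := X = set0 \/ [/\ is_subring X, (A `<=` X)%classic & ~ X pi^-1].
have [|V [PV maxV]] := @Zorn_bigcup _ P.
  move=> F FP Ftot.
  have [allF0|] := pselect (forall X, F X -> X = set0).
    by left; apply/seteqP; split=> // x [X /allF0->].
  move=> /existsNP[X0 /not_implyP[FX0 X0neq0]]; right.
  have inF X x : F X -> X x -> [/\ is_subring X, (A `<=` X)%classic & ~ X pi^-1].
    by move=> FX Xx; case: (FP X FX) => // X0'; rewrite X0' in Xx.
  have [sX0 AX0 _] : [/\ is_subring X0, (A `<=` X0)%classic & ~ X0 pi^-1].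
    by case: (FP X0 FX0).
  have common x y : (\bigcup_(X in F) X)%classic x -> (\bigcup_(X in F) X)%classic y ->
      exists X, [/\ F X, is_subring X, X x & X y].
    move=> [X FX Xx] [Y FY Yy]; have [XY|YX] := Ftot X Y FX FY.
      by exists Y; have [sY _ _] := inF Y y FY Yy; split => //; apply: XY.
    by exists X; have [sX _ _] := inF X x FX Xx; split => //; apply: YX.
  split.
  - split; first by exists X0 => //; apply: subring1.
      by move=> x y /common xU /xU[X [FX sX Xx Xy]]; exists X => //; apply: subringB.
    by move=> x y /common xU /xU[X [FX sX Xx Xy]]; exists X => //; apply: subringM.
  - by move=> x Ax; exists X0 => //; apply: AX0.
  - by move=> [X FX Xpi]; have [_ _] := inF X _ FX Xpi.
have [sV AV V'pi] : [/\ is_subring V, (A `<=` V)%classic & ~ V pi^-1].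
  case: PV => // V0; exfalso; apply: (maxV A); last by right; split.
  rewrite V0; split; first by apply: sub0set.
  by move=> /(_ 1 (subring1 sA)).
exists V; split=> //; split => // x.
apply: (@maximal_subring_total _ pi) => // [|{}x V'x]; first exact: AV.
have [//|adj'] := pselect (adjoin V x pi^-1).
exfalso; apply: (maxV (adjoin V x)).
  split=> [y|/(_ x)]; first exact: sub_adjoin.
  by move=> /(_ (mem_adjoin x sV)).
right; split=> //; first exact: adjoin_subring.
by move=> y /AV; apply: sub_adjoin.
Qed.

End Subring.

(** The ring to extend is the localization of [R] at the prime ideal [ker phi], embedded by [iota]:
    elements outside the kernel become invertible, and [pi], lying in it, does not. It serves for
    reduction modulo a prime, on integer polynomials and on integers. *)
Lemma valuation_ring_over_prime (R : comNzRingType) (F : idomainType) (L : fieldType)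
    (phi : {rmorphism R -> F}) (iota : {rmorphism R -> L}) (pi : R) :
    injective iota -> pi != 0 -> phi pi = 0 ->
  exists V : L -> Prop, [/\ is_valuation_ring V, forall x, V (iota x),
    forall s, phi s != 0 -> V (iota s)^-1 & ~ V (iota pi)^-1].
Proof.
move=> inj_iota pi0 phi_pi.
pose A y := exists x s, phi s != 0 /\ y = iota x / iota s.
have iota0 s : phi s != 0 -> iota s != 0.
  by apply: contra => /eqP s0; have -> : s = 0 by [apply: inj_iota; rewrite s0 rmorph0]; rewrite rmorph0.
have Aiota x : A (iota x) by exists x, 1; rewrite !rmorph1 divr1 oner_neq0.
have [|||V [vV AV V'pi]] := @valuation_ring_extension L A (iota pi).
- split; first by rewrite -(rmorph1 iota); apply: Aiota.
    move=> y z [x [s [s0 ->]]] [x' [s' [s'0 ->]]]; exists (x * s' - x' * s), (s * s').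
    rewrite !rmorphM mulf_neq0 // rmorphB !rmorphM; split => //.
    by field; rewrite !iota0.
  move=> y z [x [s [s0 ->]]] [x' [s' [s'0 ->]]]; exists (x * x'), (s * s').
  by rewrite !rmorphM mulf_neq0 //; split => //; field; rewrite !iota0.
- exact: Aiota.
- move=> [x [s [s0 piE]]]; have ipi0 : iota pi != 0.
    by apply: contra pi0 => /eqP ipi0; apply/eqP/inj_iota; rewrite ipi0 rmorph0.
  suff sE : s = pi * x by move: s0; rewrite sE rmorphM phi_pi mul0r eqxx.
  apply: inj_iota; rewrite rmorphM -[iota x](divfK (iota0 s s0)) -piE.
  by rewrite mulVKf.
exists V; split => //; first by move=> x; apply: AV.
by move=> s s0; apply: AV; exists 1, s; rewrite rmorph1 mul1r.
Qed.

(** * Units and maximal ideal of a valuation ring *)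

Section ValuationRing.
Variables (L : fieldType) (V : L -> Prop).
Hypothesis vV : is_valuation_ring V.
Implicit Types x y z : L.

Let sV : is_subring V := valuation_subring vV.

(** The maximal ideal of [V]. Zero is listed apart because [0^-1 = 0] lies in [V]. *)
Definition vsmall x := x = 0 \/ ~ V x^-1.
Definition vunit x := [/\ x != 0, V x & V x^-1].

Lemma vsmallW x : vsmall x -> V x.
Proof. by case=> [->|V'x]; [apply: subring0|case: (valuation_total vV x)]. Qed.

Lemma vunitW x : vunit x -> V x. Proof. by case. Qed.

Lemma vunit_neq0 x : vunit x -> x != 0. Proof. by case. Qed.

Lemma vunit_or_small x : V x -> vunit x \/ vsmall x.
Proof.
move=> Vx; have [->|x0] := eqVneq x 0; first by right; left.
by have [Vx'|V'x'] := pselect (V x^-1); [left|right; right].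
Qed.

Lemma vunit_not_small x : vunit x -> ~ vsmall x.
Proof. by case=> x0 _ Vx' [/eqP|//]; rewrite (negPf x0). Qed.

Lemma big_inv_small x : ~ V x -> vsmall x^-1.
Proof. by move=> V'x; right; rewrite invrK. Qed.

Lemma big_neq0 x : ~ V x -> x != 0.
Proof. by apply: contra_notN => /eqP ->; apply: subring0. Qed.

Lemma vsmallM x y : vsmall x -> V y -> vsmall (x * y).
Proof.
move=> sx Vy; have [->|xy0] := eqVneq (x * y) 0; [by left|right => Vxy].
move: xy0; rewrite mulf_eq0 => /norP[x0 y0].
case: sx => [/eqP|]; [by rewrite (negPf x0)|apply].
have -> : x^-1 = y * (x * y)^-1 by rewrite invfM mulrCA mulfV // mulr1.
exact: (subringM sV).
Qed.

Lemma vsmallMl x y : V x -> vsmall y -> vsmall (x * y).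
Proof. by move=> Vx sy; rewrite mulrC; apply: vsmallM. Qed.

Lemma vsmall0 : vsmall 0. Proof. by left. Qed.

Lemma vsmallN x : vsmall x -> vsmall (- x).
Proof. by rewrite -mulrN1 => sx; apply: vsmallM => //; apply/(subringN sV)/(subring1 sV). Qed.

Lemma vsmallD x y : vsmall x -> vsmall y -> vsmall (x + y).
Proof.
move=> sx sy; have [->|y0] := eqVneq y 0; first by rewrite addr0.
have [->|x0] := eqVneq x 0; first by rewrite add0r.
have [Vxy|] := valuation_total vV (x / y).
  have -> : x + y = y * (x / y + 1) by rewrite mulrDr mulr1 mulrC divfK.
  by apply: vsmallM => //; apply: (subringD sV) => //; apply: subring1.
rewrite invf_div => Vyx; have -> : x + y = x * (1 + y / x) by rewrite mulrDr mulr1 mulrCA mulfV ?mulr1.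
by apply: vsmallM => //; apply: (subringD sV) => //; apply: subring1.
Qed.

Lemma vsmallB x y : vsmall x -> vsmall y -> vsmall (x - y).
Proof. by move=> sx sy; apply: vsmallD => //; apply: vsmallN. Qed.

Lemma vunit1 : vunit 1.
Proof. by split; rewrite ?invr1 ?oner_neq0 //; apply: subring1. Qed.

Lemma vunitM x y : vunit x -> vunit y -> vunit (x * y).
Proof.
move=> [x0 Vx Vx'] [y0 Vy Vy']; split; first by rewrite mulf_neq0.
  exact: (subringM sV).
by rewrite invfM; apply: (subringM sV).
Qed.

Lemma vunitV x : vunit x -> vunit x^-1.
Proof. by move=> [x0 Vx Vx']; split; rewrite ?invrK ?invr_eq0. Qed.

Lemma vunitN x : vunit x -> vunit (- x).
Proof. by move=> [x0 Vx Vx']; split; rewrite ?invrN ?oppr_eq0 //; apply: (subringN sV). Qed.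

Lemma vunitX x n : vunit x -> vunit (x ^+ n).
Proof.
by move=> ux; elim: n => [|n IH]; [rewrite expr0; apply: vunit1|rewrite exprS; apply: vunitM].
Qed.

Lemma vunit_div x y : vunit x -> vunit y -> vunit (x / y).
Proof. by move=> ux uy; apply: vunitM => //; apply: vunitV. Qed.

Lemma vunit_prod (I : Type) (r : seq I) (P : pred I) (F : I -> L) :
  (forall i, P i -> vunit (F i)) -> vunit (\prod_(i <- r | P i) F i).
Proof. by move=> uF; apply: big_ind => //; [apply: vunit1|apply: vunitM]. Qed.

Lemma vunitD_small x y : vunit x -> vsmall y -> vunit (x + y).
Proof.
move=> ux sy; have [//|sxy] : vunit (x + y) \/ vsmall (x + y).
  by apply: vunit_or_small; apply: (subringD sV); [apply: vunitW|apply: vsmallW].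
by case: (vunit_not_small ux); rewrite -(addrK y x); apply: vsmallB.
Qed.

Lemma vsmall_prod (I : Type) (r : seq I) (P : pred I) (F : I -> L) :
  (forall i, P i -> V (F i)) -> vsmall (\prod_(i <- r | P i) F i) ->
  exists2 i, P i & vsmall (F i).
Proof.
move=> VF sF; apply: contrapT => nex; apply: (vunit_not_small _ sF).
apply: vunit_prod => i Pi; have [//|sFi] := vunit_or_small (VF i Pi).
by case: nex; exists i.
Qed.

Lemma vunit_bigB x y : ~ V x -> V y -> vunit ((x - y) / x).
Proof.
move=> V'x Vy; have -> : (x - y) / x = 1 + - (y / x).
  by rewrite mulrBl mulfV ?big_neq0.
by apply: (vunitD_small vunit1); apply/vsmallN/vsmallMl => //; apply: big_inv_small.
Qed.

Lemma bigB x y : ~ V x -> V y -> ~ V (x - y).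
Proof. by move=> V'x Vy V_xy; apply: V'x; rewrite -(subrK y x); apply: (subringD sV). Qed.

Lemma vring_of_pow x n : (0 < n)%N -> V (x ^+ n) -> V x.
Proof.
move=> n0 Vxn; apply: contrapT => V'x; have V'xn : ~ V (x ^+ n); last by [].
have sx := big_inv_small V'x; have x0 := big_neq0 V'x.
have : vsmall (x ^- n).
  rewrite -exprVn -(prednK n0) exprS; apply: vsmallM => //.
  by apply: (subringX sV); apply: vsmallW.
by case=> [/eqP|]; rewrite ?invrK // invr_eq0 expf_eq0 (negPf x0) andbF.
Qed.

(** With no small factor, every factor is nonzero with inverse in [V]; the big one then makes the
    inverse of the whole product small. *)
Lemma prod_big_has_small (T : eqType) (r : seq T) (F : T -> L) i :
  V (\prod_(j <- r) F j) -> i \in r -> ~ V (F i) ->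
  exists2 j, j \in r & vsmall (F j).
Proof.
move=> Vprod ir V'Fi; apply: contrapT => nex.
have VF' j : j \in r -> F j != 0 /\ V (F j)^-1.
  move=> jr; split.
    by apply/eqP => Fj0; apply: nex; exists j => //; rewrite Fj0; left.
  by apply: contrapT => V'; apply: nex; exists j => //; right.
have sinv : vsmall (\prod_(j <- r) F j)^-1.
  rewrite -prodfV (perm_big _ (perm_to_rem ir)) big_cons; apply: vsmallM.
    exact: big_inv_small.
  by rewrite big_seq; apply: (subring_prod sV) => j /mem_rem/VF'[].
case: sinv => [/eqP|]; rewrite ?invrK // invr_eq0 prodf_seq_eq0 => /hasP[j jr /=].
by have [/negPf ->] := VF' j jr.
Qed.

End ValuationRing.

(* Evaluating P (X - b) - 1 at a zero y of P (X - b) gives \prod_r (y - r) = -1,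
   so the roots r close to y have to compensate the poles of the other factors. *)
Section RootsNearZeros.
Variables (L : fieldType) (V : L -> Prop) (m : nat) (a : 'I_m -> L) (b : L) (rs : seq L).
Hypotheses (vV : is_valuation_ring V) (Va : forall i, V (a i)) (V'b : ~ V b).
Hypothesis rsE : \prod_(i < m) ('X - (a i)%:P) * ('X - b%:P) - 1
  = \prod_(r <- rs) ('X - r%:P).

Lemma prod_sub_roots_a i : \prod_(r <- rs) (a i - r) = -1.
Proof.
move/(congr1 (horner^~ (a i))): rsE; rewrite !hornerE !horner_prod (bigD1 i) //= !hornerE.
by rewrite subrr !mul0r sub0r => ->; apply: eq_bigr => r _; rewrite !hornerE.
Qed.

Lemma prod_sub_roots_b : \prod_(r <- rs) (b - r) = -1.
Proof.
move/(congr1 (horner^~ b)): rsE; rewrite !hornerE !horner_prod.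
by rewrite subrr mulr0 sub0r => ->; apply: eq_bigr => r _; rewrite !hornerE.
Qed.

Lemma root_eq r : r \in rs -> \prod_(i < m) (r - a i) * (r - b) = 1.
Proof.
move=> r_rs; move/(congr1 (horner^~ r)): rsE; rewrite !hornerE !horner_prod.
under eq_bigr do rewrite !hornerE; rewrite [RHS](big_rem r) //= !hornerE subrr mul0r.
by move/eqP; rewrite subr_eq0 => /eqP.
Qed.

Lemma size_roots : size rs = m.+1.
Proof.
have := congr1 (fun p : {poly L} => size p) rsE; rewrite /= size_prod_XsubC => /eqP.
set p : {poly L} := \prod_(i < m) _ * _; have sp : size p = m.+2.
  rewrite /p size_Mmonic ?monicXsubC // ?monic_neq0 ?monic_prod_XsubC //.
  by rewrite size_XsubC size_prod_XsubC addn2 /= /index_enum -enumT size_enum_ord.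
rewrite size_polyDl ?sp; first by rewrite eqSS => /eqP.
by rewrite size_polyN size_poly1.
Qed.

Lemma exists_big_root : exists2 r, r \in rs & ~ V r.
Proof.
apply: contrapT => nex; have Vrs r : r \in rs -> V r.
  by move=> r_rs; apply: contrapT => V'r; apply: nex; exists r.
have [r0 r0_rs] : exists r0, r0 \in rs.
  by move: size_roots; case: (rs) => // r0 s _; exists r0; rewrite inE eqxx.
have [||r r_rs /vsmallW-/(_ vV)] := @prod_big_has_small _ _ vV _ rs (fun r => b - r) r0 _ r0_rs.
- by rewrite prod_sub_roots_b; apply/(subringN vV)/(subring1 vV).
- by apply: bigB => //; apply: Vrs.
- by apply: bigB => //; apply: Vrs.
Qed.

Lemma exists_root_near i : exists r, [/\ r \in rs, V r & vsmall V (r - a i)].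
Proof.
have [r0 r0_rs V'r0] := exists_big_root.
have [||r r_rs /vsmallN-/(_ vV)] := @prod_big_has_small _ _ vV _ rs (fun r => a i - r) r0 _ r0_rs.
- by rewrite prod_sub_roots_a; apply/(subringN vV)/(subring1 vV).
- move=> V_; apply: V'r0; rewrite -(subKr (a i) r0); exact: (subringB vV).
rewrite opprB => s; exists r; split => //.
by rewrite -(subrK (a i) r); apply: (subringD vV) => //; apply: vsmallW.
Qed.

(** Each [a i] attracts a root, and a root near both [a i] and [a j] would make their difference
    small. The additional root is one outside [V]. *)
Lemma separated_roots (D : {set 'I_m}) :
  (forall i j, i \in D -> j \in D -> i != j -> vunit V (a i - a j)) ->
  exists s : seq L, [/\ uniq s, size s = #|D|.+1, {subset s <= rs} &
    forall r, r \in s -> ~ V r \/ exists2 i, i \in D & vsmall V (r - a i)].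
Proof.
move=> aD; have [r0 r0_rs V'r0] := exists_big_root.
have [g gP] := choice exists_root_near.
exists (r0 :: [seq g i | i <- enum D]); split.
- rewrite /= map_inj_in_uniq ?enum_uniq ?andbT.
    by apply/mapP => -[i _ r0E]; apply: V'r0; rewrite r0E; case: (gP i).
  move=> i j; rewrite !mem_enum => iD jD gE; apply/eqP; apply: contrapT => /negP ij.
  apply: (vunit_not_small (aD i j iD jD ij)).
  have [_ _ si] := gP i; have [_ _ sj] := gP j.
  have -> : a i - a j = (g j - a j) - (g i - a i) by rewrite gE; ring.
  exact: vsmallB.
- by rewrite /= size_map cardE.
- move=> r; rewrite inE => /predU1P[->//|/mapP[i _ ->]]; by case: (gP i).
- move=> r; rewrite inE => /predU1P[->|/mapP[i iD ->]]; [by left|right].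
  by exists i; [rewrite mem_enum in iD|case: (gP i)].
Qed.

Lemma uniq_roots : (forall i j, i != j -> vunit V (a i - a j)) -> uniq rs.
Proof.
move=> aU; have [i j _ _|s [s_uniq sz_s sub_s _]] := @separated_roots [set: 'I_m]; first exact: aU.
by apply: leq_size_uniq s_uniq sub_s _; rewrite sz_s size_roots cardsT card_ord.
Qed.

End RootsNearZeros.

(** * Approximation by elements of the base field *)

Section Closure.
Variables (K : fieldType) (L : fieldExtType K) (V : L -> Prop) (pi : K).
Hypotheses (vV : is_valuation_ring V) (pi0 : pi != 0) (s_pi : vsmall V pi%:A).
(** On [K] the valuation is discrete with uniformizer [pi]; the valuation of [c] is the integer
    [j - i], written with natural exponents. *)
Hypothesis VK : forall c : K, c != 0 ->
  exists i j, vunit V (c%:A * pi%:A ^+ i / pi%:A ^+ j).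
Implicit Types x y z : L.

Local Notation piL := (pi%:A : L).

Let piA0 : piL != 0. Proof. by rewrite scaler_eq0 oner_eq0 orbF. Qed.
Let piX0 n : piL ^+ n != 0. Proof. exact: expf_neq0. Qed.
Let Vpi : V piL. Proof. exact: vsmallW. Qed.
Let VpiX n : V (piL ^+ n). Proof. exact: (subringX vV). Qed.

Lemma uniformizer_pow_inj i j : vunit V (piL ^+ i / piL ^+ j) -> i = j.
Proof.
wlog ltij : i j / (i < j)%N => [hw|] u.
  case: (ltngtP i j) => // lt; first exact: hw u.
  by apply/esym; apply: hw lt _; rewrite -invf_div; apply: vunitV.
case: (vunit_not_small (vunitV u)); rewrite invf_div -(subnK (ltnW ltij)) exprD mulfK //.
case: (j - i)%N (subn_gt0 i j) => [|n _]; first by rewrite ltij.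
by rewrite exprS; apply: vsmallM.
Qed.

Lemma integral_in_valuation_ring d (e : nat -> L) y :
  (forall i, (i < d)%N -> V (e i)) -> y ^+ d = \sum_(i < d) e i * y ^+ i -> V y.
Proof.
move=> Ve yE; apply: contrapT => V'y; have sy := big_inv_small V'y.
have y0 := big_neq0 vV V'y; apply: (vunit_not_small (vunit1 vV)).
have -> : 1 = \sum_(i < d) e i * y^-1 ^+ (d - i).
  rewrite -[LHS](mulfV (expf_neq0 d y0)) {1}yE mulr_suml; apply: eq_bigr => i _.
  rewrite -mulrA; congr (_ * _); apply: canLR (mulfK _) _; first exact: expf_neq0.
  rewrite exprVn; apply: esym; apply: canLR (mulKf _) _; first exact: expf_neq0.
  by rewrite -exprD subnK // ltnW.
apply: big_ind => [|x z|i _]; [exact: vsmall0|exact: (vsmallD vV)|].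
apply: (vsmallMl vV); first exact: Ve.
have di : (0 < d - i)%N by rewrite subn_gt0.
by rewrite -(prednK di) exprS; apply: (vsmallM vV) => //; apply/(subringX vV)/(vsmallW vV).
Qed.

Lemma pi_pow_mul_mono x i j : (i <= j)%N -> V (piL ^+ i * x) -> V (piL ^+ j * x).
Proof. by move=> le Vx; rewrite -(subnK le) exprD -mulrA; apply: (subringM vV). Qed.

(** Nothing in the construction of [V] excludes elements infinitely large against [pi]. On [K] this
    is [VK]; for [x] in [L], scaling by a large power of [pi] brings the coefficients of the minimal
    polynomial into [V], which is integrally closed. *)
Lemma valuation_archimedean x : exists N, V (piL ^+ N * x).
Proof.
have archK (c : K) : exists N, V (piL ^+ N * c%:A).
  have [->|/VK[i [j u]]] := eqVneq c 0; first by exists 0%N; rewrite scale0r mulr0; apply: (subring0 vV).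
  exists i; rewrite mulrC -(divfK (piX0 j) (_ * _)); apply: (subringM vV) => //.
  exact: vunitW.
set p := minPoly 1 x; have /polyOver1P[q pE] : p \is a polyOver 1%VS by apply: minPolyOver.
have [g gP] := choice (fun i : nat => archK q`_i).
pose d := (size p).-1; pose N := (\max_(i < d) g i)%N.
have sp : size p = d.+1 by rewrite prednK // size_minPoly.
exists N; pose y := piL ^+ N * x.
apply: (@integral_in_valuation_ring d (fun i => - (q`_i)%:A * piL ^+ (N * (d - i)))).
  move=> i lt_id; rewrite mulNr; apply: (subringN vV); rewrite mulrC.
  apply: pi_pow_mul_mono (gP i); apply: (@leq_trans N).
    exact: (leq_bigmax (Ordinal lt_id)).
  by rewrite leq_pmulr // subn_gt0.
have : p.[x] = 0 by apply/eqP/root_minPoly.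
rewrite horner_coef sp big_ord_recr /=.
have -> : p`_d = 1 by apply/eqP; apply: monic_minPoly.
rewrite mul1r => /eqP; rewrite addrC addr_eq0 => /eqP xE.
rewrite exprMn xE mulrN mulr_sumr -sumrN; apply: eq_bigr => i _.
rewrite pE coef_map /= exprMn !mulNr -!mulrA; congr (- _).
rewrite mulrCA; congr (_ * _); rewrite mulrA -!exprM -exprD; congr (_ ^+ _ * _).
by rewrite -mulnDr subnK // ltnW.
Qed.

(* The elements of L lying in the completion of K. *)
Definition in_completion x := forall N, exists c : K, V ((x - c%:A) / piL ^+ N).

Lemma in_completion_base (c : K) : in_completion c%:A.
Proof. by move=> N; exists c; rewrite subrr mul0r; apply: (subring0 vV). Qed.

Lemma in_completionD x y : in_completion x -> in_completion y -> in_completion (x + y).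
Proof.
move=> cx cy N; have [c Vc] := cx N; have [d Vd] := cy N; exists (c + d).
have -> : (x + y - (c + d)%:A) / piL ^+ N = (x - c%:A) / piL ^+ N + (y - d%:A) / piL ^+ N.
  by rewrite scalerDl; ring.
exact: (subringD vV).
Qed.

Lemma in_completionM x y : in_completion x -> in_completion y -> in_completion (x * y).
Proof.
move=> cx cy N; have [n1 V1] := valuation_archimedean x; have [n2 V2] := valuation_archimedean y.
pose n := maxn n1 n2.
have Vx : V (piL ^+ n * x) by apply: pi_pow_mul_mono V1; apply: leq_maxl.
have Vy : V (piL ^+ n * y) by apply: pi_pow_mul_mono V2; apply: leq_maxr.
(* Each error is multiplied by the other factor, whose denominator is at most [pi ^+ n]; hence the
   order [N + n]. *)
have [c Vc] := cx (N + n)%N; have [d Vd] := cy (N + n)%N; exists (c * d).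
set u := (_ / _) in Vc; set v := (_ / _) in Vd.
have xE : c%:A = x - u * (piL ^+ N * piL ^+ n) by rewrite -exprD divfK // subKr.
have yE : d%:A = y - v * (piL ^+ N * piL ^+ n) by rewrite -exprD divfK // subKr.
have -> : (x * y - (c * d)%:A) / piL ^+ N
    = v * (piL ^+ n * x) + u * (piL ^+ n * y) - u * v * piL ^+ N * piL ^+ n * piL ^+ n.
  have -> : (c * d)%:A = c%:A * d%:A :> L by rewrite mulr_algl scalerA.
  by rewrite xE yE; field.
apply: (subringB vV); first by apply: (subringD vV); apply: (subringM vV).
by do !apply: (subringM vV) => //; apply: VpiX.
Qed.

Lemma in_completion_adjoin (s : seq L) :
  (forall x, x \in s -> in_completion x) -> forall x, x \in <<1 & s>>%VS -> in_completion x.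
Proof.
elim/last_ind: s => [|s z IH] cs x.
  by rewrite adjoin_nil subfield_closed => /vlineP[c ->]; apply: in_completion_base.
rewrite adjoin_rcons => /Fadjoin_polyP[p /polyOverP pM ->].
have cz : in_completion z by apply: cs; rewrite mem_rcons inE eqxx.
have cp i : in_completion p`_i.
  by apply: (IH _ _ (pM i)) => y ys; apply: cs; rewrite mem_rcons inE ys orbT.
rewrite horner_coef; apply: big_ind => [|? ?|i _].
- by rewrite -(scale0r (1 : L)); apply: in_completion_base.
- exact: in_completionD.
- apply: in_completionM => //; elim: (nat_of_ord i) => [|n IHn].
    by rewrite expr0 -(scale1r (1 : L)); apply: in_completion_base.
  by rewrite exprS; apply: in_completionM.
Qed.

Lemma in_completion_valuation x : x != 0 -> in_completion x ->
  exists i j, vunit V (x * piL ^+ i / piL ^+ j).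
Proof.
(* Since [pi ^+ N / x] lies in [V], approximation to order [N.+1] makes the relative error
   [(x - c) / x] small, so [x] and [c] agree up to a unit. *)
move=> x0 cx; have [N VN] := valuation_archimedean x^-1; have [c Vc] := cx N.+1.
have u : vunit V (c%:A / x).
  have -> : c%:A / x = 1 - (x - c%:A) / piL ^+ N.+1 * (piL ^+ N * x^-1) * piL.
    by rewrite exprS; field; rewrite x0 piA0 piX0.
  apply: (vunitD_small vV (vunit1 vV)); apply/(vsmallN vV)/(vsmallMl vV) => //.
  exact: (subringM vV).
have c0 : c != 0.
  by apply/eqP => c0; case: u => /eqP + _ _; rewrite c0 scale0r mul0r.
have [i [j v]] := VK c0; exists i, j.
have -> : x * piL ^+ i / piL ^+ j = c%:A * piL ^+ i / piL ^+ j / (c%:A / x).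
  by field; rewrite x0 piX0 scaler_eq0 (negPf c0) oner_eq0.
exact: (vunit_div vV).
Qed.

Lemma in_completion_pow_dvd x k d :
  in_completion x -> vunit V (x ^+ k / piL ^+ d) -> (0 < k)%N -> (k %| d)%N.
Proof.
move=> cx u k0; have x0 : x != 0.
  by apply/eqP => x0; case: u => /eqP + _ _; rewrite x0 expr0n eqn0Ngt k0 mul0r.
have [i [j v]] := in_completion_valuation x0 cx.
have /uniformizer_pow_inj E : vunit V (piL ^+ (i * k + d) / piL ^+ (j * k)).
  have -> : piL ^+ (i * k + d) / piL ^+ (j * k) = (x * piL ^+ i / piL ^+ j) ^+ k / (x ^+ k / piL ^+ d).
    rewrite !exprMn exprVn exprD !exprM; field.
    by rewrite !expf_neq0.
  by apply: (vunit_div vV) => //; apply: (vunitX vV).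
by rewrite -(dvdn_addr _ (dvdn_mull i (dvdnn k))) E dvdn_mull.
Qed.

(** Abstracts polynomial functions with coefficients in both [K] and [V], keeping what the fixed
    point iteration consumes; the three properties pass from affine factors to products. *)
Record admissible (D : L -> L) : Prop := Admissible {
  admissibleV : forall x, V x -> V (D x);
  admissible_lipschitz : forall x y, V x -> V y -> exists2 q, V q & D x - D y = (x - y) * q;
  admissible_base : forall c : K, exists d : K, D c%:A = d%:A }.

Lemma admissible_affine (u v : K) : V u%:A -> V v%:A ->
  admissible (fun x => u%:A + v%:A * x).
Proof.
move=> Vu Vv; split.
- by move=> x Vx; apply: (subringD vV) => //; apply: (subringM vV).
- by move=> x y _ _; exists v%:A => //; ring.
- by move=> c; exists (u + v * c); rewrite scalerDl mulr_algl scalerA.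
Qed.

Lemma admissibleM D E : admissible D -> admissible E -> admissible (fun x => D x * E x).
Proof.
move=> aD aE; split.
- by move=> x Vx; apply: (subringM vV); apply: admissibleV.
- move=> x y Vx Vy; have [q Vq qE] := admissible_lipschitz aD Vx Vy.
  have [s Vs sE] := admissible_lipschitz aE Vx Vy; exists (q * E x + D y * s).
    by apply: (subringD vV); apply: (subringM vV) => //; apply: admissibleV.
  have -> : D x * E x - D y * E y = (D x - D y) * E x + D y * (E x - E y) by ring.
  by rewrite qE sE; ring.
- move=> c; have [d ->] := admissible_base aD c; have [e ->] := admissible_base aE c.
  by exists (d * e); rewrite mulr_algl scalerA.
Qed.

Lemma admissible_prod (I : Type) (r : seq I) (P : pred I) (F : I -> L -> L) :
  (forall i, P i -> admissible (F i)) -> admissible (fun x => \prod_(i <- r | P i) F i x).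
Proof.
move=> aF; elim: r => [|i r IH].
  suff -> : (fun x => \prod_(i <- [::] | P i) F i x) = (fun x => 1%:A + 0%:A * x).
    apply: admissible_affine; rewrite ?scale0r ?scale1r; first exact: (subring1 vV).
    exact: (subring0 vV).
  by apply: funext => x; rewrite big_nil scale1r scale0r mul0r addr0.
have -> : (fun x => \prod_(j <- i :: r | P j) F j x) =
    if P i then (fun x => F i x * \prod_(j <- r | P j) F j x)
    else (fun x => \prod_(j <- r | P j) F j x).
  by apply: funext => x; rewrite big_cons; case: (P i).
by case Pi : (P i) => //; apply: admissibleM => //; apply: aF.
Qed.

(* x = u + pi v / D(x) is the fixed point of a contraction defined over K. *)
Lemma in_completion_fixpoint (u v : K) D x : V u%:A -> V v%:A -> admissible D ->
  V x -> vunit V (D x) -> x = u%:A + piL * v%:A / D x -> in_completion x.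
Proof.
move=> Vu Vv aD Vx uD xE.
(* The iteration is [c |-> u + pi * v / D c], started at [u]. By the Lipschitz bound [D c] is a unit
   along with [D x], and the new error is the old one times [pi] and an element of [V]. *)
have step N : exists c : K, V c%:A /\ V ((x - c%:A) / piL ^+ N.+1).
  elim: N => [|N [c [Vc IH]]].
    exists u; split=> //; have -> : (x - u%:A) / piL ^+ 1 = v%:A / D x.
      by rewrite {1}xE; field; case: uD => ->.
    by apply: (subringM vV) => //; case: uD.
  have [q Vq qE] := admissible_lipschitz aD Vc Vx.
  have [d dE] := admissible_base aD c.
  have uDc : vunit V (D c%:A).
    rewrite -(subrK (D x) (D _)) addrC qE; apply: (vunitD_small vV) => //.
    apply: (vsmallM vV) => //; rewrite -opprB; apply: (vsmallN vV).
    rewrite -(divfK (piX0 N.+1) (x - _)); apply: (vsmallMl vV) => //.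
    by rewrite exprS; apply: (vsmallM vV).
  have cE : (u + pi * v / d)%:A = u%:A + piL * v%:A / D c%:A :> L.
    rewrite dE; have : in_alg L (u + pi * v / d)
        = in_alg L u + in_alg L pi * in_alg L v / in_alg L d.
      by rewrite rmorphD !rmorphM fmorphV.
    by [].
  exists (u + pi * v / d); rewrite cE; split.
    apply: (subringD vV) => //; apply: (subringM vV); last by case: uDc.
    exact: (subringM vV).
  have -> : (x - (u%:A + piL * v%:A / D c%:A)) / piL ^+ N.+2
      = - ((x - c%:A) / piL ^+ N.+1) * q * v%:A / (D x) / (D c%:A).
    rewrite {1}xE; have Dx0 := vunit_neq0 uD; have Dc0 := vunit_neq0 uDc.
    have -> : u%:A + piL * v%:A / D x - (u%:A + piL * v%:A / D c%:A)
        = piL * v%:A * ((D c%:A - D x) / (D x * D c%:A)) by field; rewrite Dx0 Dc0.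
    by rewrite qE exprS; field; rewrite Dx0 Dc0 piA0 piX0.
  have [_ _ V1] := uD; have [_ _ V2] := uDc.
  by do !apply: (subringM vV) => //; apply: (subringN vV).
case=> [|N]; last by have [c [_ Vc]] := step N; exists c.
by exists 0; rewrite scale0r subr0 expr0 divr1.
Qed.

End Closure.

(** * Ramified clusters of roots *)

Section Cluster.
Variables (K : fieldType) (L : splittingFieldType K) (V : L -> Prop) (pi : K).
Hypotheses (vV : is_valuation_ring V) (pi0 : pi != 0) (s_pi : vsmall V pi%:A).
Hypothesis VK : forall c : K, c != 0 ->
  exists i j, vunit V (c%:A * pi%:A ^+ i / pi%:A ^+ j).
Variables (m : nat) (a : 'I_m -> K) (b : K) (rs : seq L) (D : {set 'I_m}).
Hypotheses (D_gt1 : (1 < #|D|)%N) (u_b : vunit V (pi%:A * b%:A)).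
Hypothesis aD : forall i, i \in D -> V ((a i)%:A / pi%:A).
Hypothesis aD' : forall i, i \notin D -> vunit V (a i)%:A.
Hypothesis aD'B : forall i j, i \notin D -> j \notin D -> i != j ->
  vunit V ((a i)%:A - (a j)%:A).
Hypothesis rsE : \prod_(i < m) ('X - ((a i)%:A)%:P) * ('X - (b%:A)%:P) - 1
  = \prod_(r <- rs) ('X - r%:P).
Hypotheses (uniq_rs : uniq rs) (galL : galois 1 {:L}).

Local Notation piL := (pi%:A : L).
Local Notation clustered r := (vunit V (r ^+ #|D| / piL)).

Let piA0 : piL != 0. Proof. by rewrite scaler_eq0 oner_eq0 orbF. Qed.
Let Vpi : V piL. Proof. exact: vsmallW. Qed.

Let small_a i : i \in D -> vsmall V (a i)%:A.
Proof. by move=> iD; rewrite -(divfK piA0 (a i)%:A); apply: (vsmallMl vV) => //; apply: aD. Qed.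

Let Va i : V (a i)%:A.
Proof.
by have [/small_a/(vsmallW vV)|/aD'/vunitW] := boolP (i \in D).
Qed.

Let V'b : ~ V b%:A.
Proof. by move=> Vb; apply: (vunit_not_small u_b); apply: (vsmallM vV). Qed.

Let separated j i : j \notin D -> i != j -> vunit V ((a j)%:A - (a i)%:A).
Proof.
move=> jD ij; have [iD|iD] := boolP (i \in D); last by apply: aD'B => //; rewrite eq_sym.
by apply: (vunitD_small vV); [apply: aD'|apply: (vsmallN vV); apply: small_a].
Qed.

Let m_gt0 : (0 < m)%N.
Proof. by rewrite -(card_ord m) (leq_trans _ (max_card (mem D))) // ltnW. Qed.

Let Veq r := @root_eq L m (fun i => (a i)%:A) b%:A rs rsE r.

(** Solved for [d = r - b], the equation is [d = pi ^+ m / E d]: every factor [d + b - a i] is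
    multiplied by [pi] to become a unit with dominant part [pi * b]. As [m > 0], a factor [pi] is
    available for the contraction. *)
Lemma big_root_in_completion r : r \in rs -> ~ V r -> in_completion V pi r.
Proof.
move=> r_rs V'r; have eq1 := Veq r_rs.
suff cd : in_completion V pi (r - b%:A).
  by rewrite -(subrK b%:A r); apply: in_completionD => //; apply: in_completion_base.
have dE : r - b%:A = (\prod_(i < m) (r - (a i)%:A))^-1.
  by apply: esym; apply: mulr1_eq.
have Vd : V (r - b%:A).
  rewrite dE -prodfV; apply: (subring_prod vV) => i _.
  by apply: (vsmallW vV); apply: big_inv_small => //; apply: bigB.
pose E x : L := \prod_(i < m) ((pi * b - pi * a i)%:A + pi%:A * x).
have pibE i : (pi * b - pi * a i)%:A = piL * b%:A - piL * (a i)%:A :> L.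
  by rewrite scalerBl !mulr_algl !scalerA.
have EE : E (r - b%:A) = piL ^+ m * \prod_(i < m) (r - (a i)%:A).
  rewrite -[m in piL ^+ m]card_ord -prodr_const -big_split /=; apply: eq_bigr => i _.
  by rewrite pibE; ring.
apply: (@in_completion_fixpoint _ _ _ _ vV pi0 s_pi 0 (pi ^+ m.-1) E).
- by rewrite scale0r; apply: (subring0 vV).
- have -> : (pi ^+ m.-1)%:A = piL ^+ m.-1 := rmorphXn (in_alg L) _ _.
  exact: (subringX vV).
- apply: admissible_prod => // i _; apply: admissible_affine => //.
  rewrite pibE; apply: (subringB vV); first exact: vunitW.
  exact: (subringM vV).
- by [].
- apply: (vunit_prod vV) => i _; rewrite pibE -addrA; apply: (vunitD_small vV) => //.
  rewrite addrC; apply: (vsmallB vV); exact: (vsmallM vV).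
- rewrite EE scale0r add0r dE.
  have -> : (pi ^+ m.-1)%:A = piL ^+ m.-1 := rmorphXn (in_alg L) _ _.
  rewrite -exprS prednK // invfM mulrA mulfV ?mul1r //.
  exact: expf_neq0.
Qed.

(** Solving for the factor [r - a j] gives [r = a j + pi / E r]. The [pi] in the denominator turns
    [r - b] into the unit [pi * (r - b)], and the other [r - a i] are units because [a j] is
    separated from every other [a i]. *)
Lemma near_root_in_completion r j : r \in rs -> j \notin D -> vsmall V (r - (a j)%:A) ->
  in_completion V pi r.
Proof.
move=> r_rs jD sr; have eq1 := Veq r_rs.
have Vr : V r by rewrite -(subrK (a j)%:A r); apply: (subringD vV) => //; apply: vsmallW.
pose E x : L := ((- (pi * b))%:A + pi%:A * x) * \prod_(i < m | i != j) ((- a i)%:A + 1%:A * x).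
have NA (c : K) : (- c)%:A = - c%:A :> L by rewrite scaleNr.
have MA (c d : K) : (c * d)%:A = c%:A * d%:A :> L by rewrite mulr_algl scalerA.
apply: (@in_completion_fixpoint _ _ _ _ vV pi0 s_pi (a j) 1 E) => //.
- by rewrite scale1r; apply: (subring1 vV).
- apply: admissibleM => //.
    apply: admissible_affine => //; rewrite NA MA; apply: (subringN vV); exact: vunitW.
  apply: admissible_prod => // i _; apply: admissible_affine => //.
    by rewrite NA; apply: (subringN vV).
  by rewrite scale1r; apply: (subring1 vV).
- apply: (vunitM vV); first rewrite NA MA.
    by apply: (vunitD_small vV); [apply: (vunitN vV)|apply: (vsmallM vV)].
  apply: (vunit_prod vV) => i ij.
  have -> : (- a i)%:A + 1%:A * r = ((a j)%:A - (a i)%:A) + (r - (a j)%:A) :> L.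
    by rewrite NA scale1r; ring.
  by apply: (vunitD_small vV) => //; apply: separated.
- move: eq1; rewrite (bigD1 j) //=.
  have -> : E r = piL * (r - b%:A) * \prod_(i < m | i != j) (r - (a i)%:A).
    rewrite /E NA MA; congr (_ * _); first by ring.
    by apply: eq_bigr => i _; rewrite NA scale1r; ring.
  set P := \prod_(i < m | _) _ => eq1.
  have : (r - (a j)%:A) * P * (r - b%:A) != 0 by rewrite eq1 oner_neq0.
  rewrite !mulf_eq0 => /norP[/norP[_ P0] rb0].
  rewrite scale1r; apply: (addIr (- (a j)%:A)); rewrite [RHS]addrAC subrr add0r.
  by apply: (mulIf P0); apply: (mulIf rb0); rewrite eq1; field; rewrite P0 rb0 piA0.
Qed.

(** The factors outside [D] are units and [r - b] has the valuation of [pi^-1], so the factors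
    inside [D] multiply to [pi] up to a unit. It remains to compare each of them with [r]. *)
Lemma clustered_root r : r \in rs -> V r ->
  (forall j, j \notin D -> ~ vsmall V (r - (a j)%:A)) -> clustered r.
Proof.
move=> r_rs Vr far; have eq1 := Veq r_rs.
pose W := piL * r - piL * b%:A.
have uW : vunit V W.
  by rewrite /W addrC; apply: (vunitD_small vV); [apply: (vunitN vV)|apply: (vsmallM vV)].
have W0 := vunit_neq0 uW.
have prodE : \prod_(i < m) (r - (a i)%:A) = piL / W.
  have rb0 : r - b%:A != 0.
    by apply: contra W0 => /eqP rb0; rewrite /W -mulrBr rb0 mulr0.
  by rewrite -[LHS](mulfK rb0) eq1 /W; field; rewrite W0 rb0.
have sP : vsmall V (\prod_(i < m) (r - (a i)%:A)).
  by rewrite prodE; apply: (vsmallM vV) => //; case: uW.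
have [i _|i _ si] := vsmall_prod vV _ sP; first exact: (subringB vV).
have iD : i \in D by apply: contrapT => /negP /far.
have sr : vsmall V r by rewrite -(subrK (a i)%:A r); apply: (vsmallD vV) => //; apply: small_a.
pose W' := \prod_(i < m | i \notin D) (r - (a i)%:A).
have uW' : vunit V W'.
  apply: (vunit_prod vV) => j jD; rewrite addrC; apply: (vunitD_small vV) => //.
  by apply: (vunitN vV); apply: aD'.
have W'0 := vunit_neq0 uW'.
have prodDE : \prod_(i in D) (r - (a i)%:A) = piL / W / W'.
  by rewrite -prodE [in RHS](bigID [in D]) /= mulfK.
have k2 : #|D| = (#|D|.-2).+2 by case: #|D| D_gt1 => [|[]].
(* Here [#|D| > 1] enters: if [r / pi] were in [V], all [#|D|] factors would be divisible by [pi],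
   while their product is [pi] up to a unit. *)
have V'r : ~ V (r / piL).
  move=> Vrpi; have : V (\prod_(i in D) ((r - (a i)%:A) / piL)).
    apply: (subring_prod vV) => j jD; rewrite mulrBl; apply: (subringB vV) => //.
    exact: aD.
  rewrite big_split /= prodDE prodr_const => VD.
  suff V1 : V piL^-1 by case: s_pi => [/eqP|//]; rewrite (negPf piA0).
  have -> : piL^-1 = piL / W / W' * piL^-1 ^+ #|D| * W * W' * piL ^+ #|D|.-2.
    by rewrite {1}k2 exprVn !exprS; field; rewrite W'0 W0 piA0 expf_neq0.
  do !apply: (subringM vV) => //; [exact: vunitW|exact: vunitW|exact: (subringX vV)].
(* Now [r] strictly dominates each [a i] with [i] in [D], so [r - a i] is [r] up to a unit. *)
pose U := \prod_(i in D) ((r - (a i)%:A) / r).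
have r0 : r != 0 by apply/eqP => r0; apply: V'r; rewrite r0 mul0r; apply: (subring0 vV).
have uU : vunit V U.
  apply: (vunit_prod vV) => j jD.
  have -> : (r - (a j)%:A) / r = (r / piL - (a j)%:A / piL) / (r / piL) by field; rewrite r0 piA0.
  by apply: (vunit_bigB vV) => //; apply: aD.
have -> : r ^+ #|D| / piL = (U * W * W')^-1.
  rewrite /U big_split /= prodDE prodr_const exprVn; field.
  by rewrite W0 W'0 piA0 expf_neq0.
by apply: (vunitV); do !apply: (vunitM vV).
Qed.

Lemma not_clustered_in_completion r : r \in rs -> ~ clustered r -> in_completion V pi r.
Proof.
move=> r_rs ncl; have [Vr|] := pselect (V r); last exact: big_root_in_completion.
have [[j [jD sj]]|nex] := pselect (exists j, j \notin D /\ vsmall V (r - (a j)%:A)).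
  exact: near_root_in_completion sj.
case: ncl; apply: clustered_root => // j jD sj; apply: nex; by exists j.
Qed.

Lemma not_clustered_of_far r :
  ~ V r \/ (exists2 i, i \in ~: D & vsmall V (r - (a i)%:A)) -> ~ clustered r.
Proof.
have k0 : (0 < #|D|)%N by rewrite ltnW.
case=> [V'r ucl|[i iD si] ucl].
  apply: V'r; apply: (vring_of_pow vV k0); rewrite -(divfK piA0 (_ ^+ _)).
  by apply: (subringM vV) => //; apply: vunitW.
have ur : vunit V r.
  rewrite -(subrK (a i)%:A r) addrC; apply: (vunitD_small vV) => //; apply: aD'.
  by rewrite inE in iD.
have := vunit_div vV (vunitX vV #|D| ur) ucl; rewrite invf_div mulrC divfK.
  by move/vunit_not_small; apply.
by rewrite expf_neq0 // (vunit_neq0 ur).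
Qed.

Lemma mem_roots r : (r \in rs) = (\prod_(i < m) (r - (a i)%:A) * (r - b%:A) == 1).
Proof.
rewrite -root_prod_XsubC -rsE rootE !hornerE horner_prod subr_eq0.
by under eq_bigr do rewrite !hornerE.
Qed.

Lemma gal_roots (g : gal_of {:L}) r : r \in rs -> g r \in rs.
Proof.
have gB (c : K) : g (r - c%:A) = g r - c%:A by rewrite rmorphB /= linearZ /= rmorph1.
rewrite !mem_roots => /eqP rE; have : g (\prod_(i < m) (r - (a i)%:A) * (r - b%:A)) = g 1.
  by rewrite rE.
rewrite rmorphM rmorph_prod rmorph1 /= gB => gE; apply/eqP; rewrite -[RHS]gE.
by congr (_ * _); apply: eq_bigr => i _; rewrite gB.
Qed.

(* The product of an orbit of clustered roots over the field generated by the
   other roots lies in the completion of K and its #|D|-th power has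
   valuation the length of the orbit, so #|D| divides this length. *)
Lemma cluster_transitive : exists C : seq L,
  [/\ uniq C, size C = #|D|, {subset C <= rs} &
   forall x y, x \in C -> y \in C -> exists2 g, g \in 'Gal({:L} / 1)%g &
     g x = y /\ forall z, z \in rs -> z \notin C -> g z = z].
Proof.
have k0 : (0 < #|D|)%N by rewrite ltnW.
pose cl := [pred r : L | `[< clustered r >]].
pose C := [seq r <- rs | cl r]; pose C' := [seq r <- rs | ~~ cl r].
pose M := <<1 & C'>>%AS; pose H := 'Gal({:L} / M)%g.
have galoisM : galois M {:L} by apply: galoisS galL; rewrite sub1v subvf.
have HC' g z : g \in H -> z \in rs -> z \notin C -> g z = z.
  move=> gH z_rs zC; apply: (fixed_gal _ gH); first exact: subvf.
  by apply: seqv_sub_adjoin; move: zC; rewrite !mem_filter z_rs !andbT.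
have HC g z : g \in H -> z \in C -> g z \in C.
  move=> gH zC; have z_rs : z \in rs by move: zC; rewrite mem_filter => /andP[].
  have gz_rs := gal_roots g z_rs; apply: contrapT => /negP gzC.
  have gV : (g^-1)%g \in H by rewrite groupV.
  have := HC' _ _ gV gz_rs gzC; rewrite -galM ?memvf // mulgV gal_id => zE.
  by move: gzC; rewrite -zE zC.
(* The complement of [D] yields [m - #|D| + 1] unclustered roots out of [m + 1]. With this bound, an
   orbit whose length is divisible by [#|D|] is all of [C]. *)
have sizeC : (size C <= #|D|)%N.
  have [i j|s [uniq_s sz_s sub_s s_far]] :=
      @separated_roots L V m (fun i => (a i)%:A) b%:A rs vV Va V'b rsE (~: D).
    by rewrite !inE => iD jD ij; apply: aD'B.
  have : (size s <= size C')%N.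
    apply: uniq_leq_size => // r rs'; rewrite mem_filter sub_s // andbT.
    by apply/asboolP; apply: not_clustered_of_far; apply: s_far.
  have := count_predC cl rs; rewrite -!size_filter -/C -/C' (size_roots rsE).
  by rewrite sz_s cardsCs finset.setCK card_ord; have := max_card (mem D); rewrite card_ord; lia.
have orbitC x : x \in C ->
    (#|D| <= size C)%N /\ forall y, y \in C -> exists2 g, g \in H & g x = y.
  move=> xC; pose O := undup [seq (g : gal_of {:L}) x | g <- enum H].
  have OC : {subset O <= C}.
    by move=> y; rewrite mem_undup => /mapP[g]; rewrite mem_enum => gH ->; apply: HC.
  have OH g y : g \in H -> y \in O -> g y \in O.
    move=> gH; rewrite !mem_undup => /mapP[h]; rewrite mem_enum => hH ->.
    by apply/mapP; exists (h * g)%g; rewrite ?mem_enum ?groupM // galM ?memvf.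
  pose c := \prod_(y <- O) y.
  have cM : c \in M.
    have /galois_fixedField <- := galoisM; apply/fixedFieldP; first exact: memvf.
    move=> g gH; rewrite rmorph_prod -(big_map g xpredT id); apply: perm_big.
    have uniq_gO : uniq (map g O) by rewrite map_inj_uniq ?undup_uniq //; apply: fmorph_inj.
    have gOO : {subset map g O <= O} by move=> y /mapP[z zO ->]; apply: OH.
    have [|_ gOE] := uniq_min_size uniq_gO gOO; first by rewrite size_map.
    by rewrite uniq_perm ?undup_uniq.
  have cc : in_completion V pi c.
    apply: (in_completion_adjoin vV pi0 s_pi VK _ cM) => r; rewrite mem_filter => /andP[/asboolPn].
    by move=> ncl r_rs; apply: not_clustered_in_completion.
  have uc : vunit V (c ^+ #|D| / piL ^+ size O).
    have -> : c ^+ #|D| / piL ^+ size O = \prod_(y <- O) (y ^+ #|D| / piL).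
      rewrite big_split /= prodrXl; congr (_ * _).
      by rewrite big_const_seq count_predT iter_mulr_1 exprVn.
    rewrite big_seq; apply: (vunit_prod vV) => y /OC.
    by rewrite mem_filter => /andP[/asboolP].
  have O0 : (0 < size O)%N.
    have : x \in O by rewrite mem_undup; apply/mapP; exists 1%g; rewrite ?mem_enum ?group1 ?gal_id.
    by case: O {OC OH c cM cc uc}.
  have szO : (#|D| <= size O)%N.
    by apply: dvdn_leq => //; apply: (in_completion_pow_dvd vV pi0 s_pi VK cc uc).
  have [_ OE] := uniq_min_size (undup_uniq _) OC (leq_trans sizeC szO).
  split; first exact: leq_trans szO (uniq_leq_size (undup_uniq _) OC).
  move=> y; rewrite -OE mem_undup => /mapP[g]; rewrite mem_enum => gH ->; by exists g.
(* [C] is not empty: a root near [a i] with [i] in [D] cannot also be near an [a j] with [j] outside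
   [D]. *)
have [i iD] : exists i, i \in D by apply/card_gt0P.
have [x [x_rs Vx sx]] := exists_root_near vV Va V'b rsE i.
have xC : x \in C.
  rewrite mem_filter x_rs andbT; apply/asboolP; apply: clustered_root => // j jD sj.
  have ij : i != j by apply: contraNneq jD => <-.
  apply: (vunit_not_small (separated jD ij)).
  have -> : (a j)%:A - (a i)%:A = (x - (a i)%:A) - (x - (a j)%:A) by ring.
  exact: (vsmallB vV).
exists C; split.
- exact: filter_uniq.
- by apply/eqP; rewrite eqn_leq sizeC; case: (orbitC x xC).
- by move=> y; rewrite mem_filter => /andP[].
- move=> y z yC zC; have [_ /(_ z zC)[g gH gyz]] := orbitC y yC.
  exists g; last by split=> // w; apply: HC'.
  have sHG : H \subset 'Gal({:L} / 1)%g by apply: galS; apply: sub1v.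
  exact: (subsetP sHG).
Qed.


End Cluster.

(** * Splitting fields *)

Lemma exists_irreducible_factor (K : fieldType) (p : {poly K}) :
  (1 < size p)%N -> exists2 r, r %| p & irreducible_poly r.
Proof.
have [n] := ubnP (size p); elim: n p => // n IH p; rewrite ltnS => le_pn p1.
have [irr|] := pselect (irreducible_poly p); first by exists p.
move=> red; have [q [q1 q_dv_p ltqp]] : exists q : {poly K}, [/\ (1 < size q)%N, q %| p & (size q < size p)%N].
  apply: contrapT => nex; apply: red; split=> // q q1 q_dv_p.
  have p0 : p != 0 by rewrite -size_poly_gt0 ltnW.
  have q0 : q != 0 by apply: dvdpN0 p0.
  rewrite -dvdp_size_eqp // eqn_leq dvdp_leq //= leqNgt; apply/negP => lt_qp; apply: nex.
  exists q; split=> //; rewrite ltn_neqAle eq_sym q1 size_poly_gt0 q0 //.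
have [r r_dv_q irr] := IH q (leq_trans ltqp le_pn) q1.
by exists r => //; apply: dvdp_trans q_dv_p.
Qed.

Lemma exists_ext_splitting (K : fieldType) (p : {poly K}) : p \is monic ->
  exists (L : fieldExtType K) (rs : seq L), map_poly (in_alg L) p = \prod_(r <- rs) ('X - r%:P).
Proof.
have [n] := ubnP (size p); elim: n => // n IH in K p *; rewrite ltnS => le_pn mp.
have [p1|p1] := leqP (size p) 1.
  exists (K^o : fieldExtType K), [::]; rewrite big_nil.
  have -> : p = 1.
    have p0 := monic_neq0 mp; have sp : size p = 1%N by apply/eqP; rewrite eqn_leq p1 size_poly_gt0.
    by rewrite (size1_polyC p1); move/monicP: mp; rewrite /lead_coef sp => ->.
  by rewrite rmorph1.
have [r /dvdpP[s pE] /irredp_FAdjoin[K1 _ [x rx0 _]]] := exists_irreducible_factor p1.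
have [q qE] : exists q, map_poly (in_alg K1) p = q * ('X - x%:P).
  by apply/factor_theorem; rewrite pE rmorphM rootM rx0 orbT.
have mq : q \is monic by rewrite -(monicMr q (monicXsubC x)) -qE map_monic.
have szq : (size q < n)%N.
  have := size_map_poly (in_alg K1) p; rewrite qE size_Mmonic ?monic_neq0 ?monicXsubC //.
  by rewrite size_XsubC addn2 /= => spE; rewrite spE.
have [L [rs qrs]] := IH K1 q szq mq.
exists (baseFieldType L), (in_alg L x :: rs); rewrite big_cons.
have -> : map_poly (in_alg (baseFieldType L)) p = map_poly (in_alg L) (map_poly (in_alg K1) p).
  rewrite -map_poly_comp; apply: eq_map_poly => c /=; exact: baseField_scaleE.
by rewrite qE rmorphM /= qrs mulrC rmorphB /= map_polyX map_polyC.
Qed.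

(** Inside an extension where [p] splits, the subfield generated by the roots has both the
    generation property and the splitting field structure that Galois theory asks for. *)
Lemma exists_splitting_field (K : fieldType) (p : {poly K}) : p \is monic ->
  exists (L : splittingFieldType K) (rs : seq L),
    map_poly (in_alg L) p = \prod_(r <- rs) ('X - r%:P) /\ <<1 & rs>>%VS = fullv.
Proof.
move=> /exists_ext_splitting[L [ys pE]].
pose E := <<1 & ys>>%AS; pose S : fieldExtType K := subvs_of E.
pose toL : {rmorphism S -> L} := vsval.
pose rs : seq S := map (vsproj E) ys.
have rsK : map toL rs = ys.
  by rewrite -map_comp map_id_in // => y y_ys; rewrite /= vsprojK // seqv_sub_adjoin.
have pS : map_poly (in_alg S) p = \prod_(r <- rs) ('X - r%:P).
  apply: (map_poly_inj toL); rewrite -map_poly_comp rmorph_prod /=.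
  rewrite (eq_map_poly (g := in_alg L)); last by move=> c /=; rewrite algid1.
  rewrite pE -[in LHS]rsK big_map; apply: eq_bigr => r _.
  by rewrite rmorphB /= map_polyX map_polyC.
have rsF : <<1 & rs>>%VS = fullv.
  apply/vspaceP => u; rewrite memvf.
  have : vsval u \in (linfun (vsval : S -> L) @: <<1 & rs>>)%VS.
    rewrite aimg_adjoin_seq aimg1 (eq_map (lfunE _)) rsK; exact: subvsP.
  by case/memv_imgP => v v_rs; rewrite lfunE => /val_inj ->.
have ax : SplittingField.axiom S.
  exists (map_poly (in_alg S) p); first by apply/polyOver1P; exists p.
  by exists rs => //; rewrite pS eqpxx.
pose spl := FieldExt_isSplittingField.Build K S ax.
pose S' : splittingFieldType K := HB.pack S spl.
by exists S', rs.
Qed.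

(** * Two-transitive groups containing a transposition *)

Section TwoTransitive.
Variables (K : fieldType) (L : splittingFieldType K) (rs C1 C2 : seq L).
Local Notation G := 'Gal({:L} / 1)%g.
Hypotheses (uniq_rs : uniq rs) (gal_rs : forall (g : gal_of {:L}) r, r \in rs -> g r \in rs).
Hypothesis moved : forall r, r \in rs -> exists2 g, g \in G & g r != r.
Hypotheses (uC1 : uniq C1) (sC1 : {subset C1 <= rs}) (szC1 : (size C1).+1 = size rs).
Hypothesis trC1 : forall x y, x \in C1 -> y \in C1 -> exists2 g, g \in G &
  g x = y /\ forall z, z \in rs -> z \notin C1 -> g z = z.
Hypotheses (uC2 : uniq C2) (sC2 : {subset C2 <= rs}) (szC2 : size C2 = 2).
Hypothesis trC2 : forall x y, x \in C2 -> y \in C2 -> exists2 g, g \in G &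
  g x = y /\ forall z, z \in rs -> z \notin C2 -> g z = z.

Let galMf (g h : gal_of {:L}) x : (g * h)%g x = h (g x).
Proof. by rewrite galM ?memvf. Qed.

Let galVK (g : gal_of {:L}) x : g^-1%g (g x) = x.
Proof. by rewrite -galMf mulgV gal_id. Qed.

Let galKV (g : gal_of {:L}) x : g (g^-1%g x) = x.
Proof. by rewrite -galMf mulVg gal_id. Qed.

Let gal_inj (g : gal_of {:L}) : injective g.
Proof. by apply: can_inj (galVK g). Qed.

Lemma isolated_root : exists r0, [/\ r0 \in rs, r0 \notin C1 &
  forall r, r \in rs -> r != r0 -> r \in C1].
Proof.
have szN : size [seq r <- rs | r \notin C1] = 1%N.
  have := count_predC [in C1] rs; rewrite -!size_filter.
  have -> : size [seq r <- rs | r \in C1] = size C1.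
    apply/perm_size/uniq_perm => //; first exact: filter_uniq.
    by move=> r; rewrite mem_filter andb_idr //; apply: sC1.
  by rewrite -szC1 -addn1 => /addnI.
case E : [seq r <- rs | r \notin C1] szN => [//|r0 [|//]] _.
have inE' r : (r \notin C1) && (r \in rs) = (r == r0).
  by rewrite -(mem_filter (fun r => r \notin C1)) E inE.
have /andP[r0C r0_rs] : (r0 \notin C1) && (r0 \in rs) by rewrite inE' eqxx.
exists r0; split=> // r r_rs; apply: contraR => rC.
by rewrite -inE' rC.
Qed.

(** The elements given by [trC1] fix the isolated root [r0], so its stabilizer is transitive on the
    other roots. Both pairs are moved to have first entry [r0], and the second entries are matched
    within [C1]. *)
Lemma gal_two_transitive x y x' y' : x \in rs -> y \in rs -> x' \in rs -> y' \in rs ->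
  x != y -> x' != y' -> exists2 g, g \in G & g x = x' /\ g y = y'.
Proof.
have [r0 [r0_rs r0C1 otherC1]] := isolated_root.
(* Some [h] moves [r0] into [C1]; the stabilizer takes [z] to [h r0], and [h^-1] brings it to
   [r0]. *)
have to_r0 z : z \in rs -> exists2 g, g \in G & g z = r0.
  move=> z_rs; have [->|zr0] := eqVneq z r0; first by exists 1%g; rewrite ?group1 ?gal_id.
  have [h hG hr0] := moved r0_rs.
  have [u uG [uE _]] := trC1 (otherC1 _ z_rs zr0) (otherC1 _ (gal_rs h r0_rs) hr0).
  by exists (u * h^-1)%g; rewrite ?groupM ?groupV // galMf uE galVK.
move=> x_rs y_rs x'_rs y'_rs xy x'y'.
have [g gG gx] := to_r0 _ x_rs; have [h hG hx] := to_r0 _ x'_rs.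
have gyC : g y \in C1.
  by apply: otherC1; [apply: gal_rs|rewrite -gx (inj_eq (@gal_inj g)) eq_sym].
have hyC : h y' \in C1.
  by apply: otherC1; [apply: gal_rs|rewrite -hx (inj_eq (@gal_inj h)) eq_sym].
have [u uG [uE ufix]] := trC1 gyC hyC.
exists (g * u * h^-1)%g; first by rewrite !groupM ?groupV.
by rewrite !galMf uE gx (ufix r0) // -hx !galVK.
Qed.

(** By injectivity, an element taking [c] to [d] and fixing the roots outside [C2] exchanges [c] and
    [d]. Conjugating by a two-transitive group carries this transposition to any pair. *)
Lemma gal_swap x y : x \in rs -> y \in rs -> x != y -> exists2 g, g \in G &
  [/\ g x = y, g y = x & forall z, z \in rs -> z != x -> z != y -> g z = z].
Proof.
move=> x_rs y_rs xy.
case: C2 uC2 sC2 szC2 trC2 => [|c [|d []]] //= /andP[]; rewrite inE => cd _ sC _ trC.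
have cC : c \in [:: c; d] by rewrite !inE eqxx.
have dC : d \in [:: c; d] by rewrite !inE eqxx orbT.
have [g gG [gc gfix]] := trC c d cC dC.
have gd : g d = c.
  apply/eqP/negPn/negP => gdc; have gd_rs := gal_rs g (sC d dC).
  have gdd : g d != d by rewrite -{2}gc (inj_eq (@gal_inj g)) eq_sym.
  have /gal_inj gdE : g (g d) = g d by apply: gfix; rewrite // !inE negb_or gdc.
  by rewrite gdE eqxx in gdd.
have [h hG [hc hd]] := gal_two_transitive (sC c cC) (sC d dC) x_rs y_rs cd xy.
exists (h^-1 * g * h)%g; first by rewrite !groupM ?groupV.
split; first by rewrite !galMf -hc galVK gc hd.
  by rewrite !galMf -hd galVK gd hc.
move=> z z_rs zx zy; rewrite !galMf gfix ?galKV ?gal_rs //.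
by rewrite !inE negb_or; apply/andP; split;
  [apply: contra zx|apply: contra zy] => /eqP E; rewrite -(galKV h z) E ?hc ?hd.
Qed.

Lemma gal_permutations (s : 'S_(size rs)) :
  exists2 g : 'End(L), kAut 1%VS fullv g & forall i : 'I_(size rs), g (rs`_i) = rs`_(s i).
Proof.
suff [g gG gE] : exists2 g, g \in G & forall i : 'I_(size rs), g (rs`_i) = rs`_(s i).
  by exists g; rewrite // -gal_kAut ?sub1v.
have [ts -> /allP ts_d] := prod_tpermP s.
elim: ts ts_d => [_|[i j] ts IH ts_d].
  by exists 1%g => [|i]; rewrite ?group1 // big_nil perm1 gal_id.
have [t tts|h hG hE] := IH; first by apply: ts_d; rewrite inE tts orbT.
have /= ij : dpair (i, j) by apply: ts_d; rewrite inE eqxx.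
have rs_neq (u v : 'I_(size rs)) : u != v -> rs`_u != rs`_v by move=> uv; rewrite nth_uniq.
have [g gG [gi gj gfix]] := gal_swap (mem_nth 0 (ltn_ord i)) (mem_nth 0 (ltn_ord j)) (rs_neq _ _ ij).
exists (g * h)%g => [|u]; first by rewrite groupM.
rewrite big_cons permM galMf -hE /=; congr (h _).
case: tpermP => [->|->|/eqP ui /eqP uj] //.
by apply: gfix; rewrite ?mem_nth ?rs_neq.
Qed.

End TwoTransitive.

(** * Gauss valuations of Q(t) *)

Lemma fraction_repr (R : idomainType) (x : {fraction R}) :
  exists n d : R, d != 0 /\ x = tofrac n / tofrac d.
Proof.
elim/quotW: x => y; exists (frac y).1, (frac y).2; have d0 : (frac y).2 != 0 by exact: denom_ratioP.
split=> //; apply: canRL (mulfK _) _; first by rewrite tofrac_eq0.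
unlock FracField.tofrac; rewrite -[LHS]FracField.pi_mul.
apply/eqmodP; rewrite /= FracField.equivfE /FracField.mulf /=.
by rewrite !numden_Ratio ?oner_eq0 ?mulr1 // mulrC.
Qed.

(** The exponent [i] is the Gauss valuation of [h]; division by [p] stops because it shrinks the
    leading coefficient. *)
Lemma primitive_decomposition (p : nat) (h : {poly int}) : prime p -> h != 0 ->
  exists i h', h = p%:Z ^+ i *: h' /\ map_poly (intr : int -> 'F_p) h' != 0.
Proof.
move=> p_pr; have [N] := ubnP `|lead_coef h|%N; elim: N h => // N IH h; rewrite ltnS => leN h0.
have [hp0|hp] := eqVneq (map_poly (intr : int -> 'F_p) h) 0; last by exists 0%N, h; rewrite expr0 scale1r.
have /polyOver_dvdzP[q hE] : h \is a polyOver (dvdz p).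
  apply/polyOverP => i; rewrite (dvdz_pcharf (pchar_Fp p_pr)).
  by have /(congr1 (fun r : {poly 'F_p} => r`_i)) := hp0; rewrite coef_map coef0 /= => ->.
have p0 : p%:Z != 0 by rewrite eqz_nat -lt0n prime_gt0.
have q0 : q != 0 by apply: contraNneq h0 => q0; rewrite hE q0 scaler0.
have [|i [h' [qE h'p]]] := IH q _ q0.
  apply: leq_trans leN; rewrite hE lead_coefZ abszM /= ltn_Pmull ?prime_gt1 //.
  by rewrite absz_gt0 lead_coef_eq0.
by exists i.+1, h'; rewrite exprS -scalerA -qE.
Qed.

(* The p-adic Gauss valuation of Q(t) with respect to the variable
   w = (t - 1) / p ^ e, extended to L. *)
Lemma gauss_valuation (p e l : nat) (L : fieldExtType Qt) : prime p -> ~~ (p %| l)%N ->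
  exists V : L -> Prop, [/\ is_valuation_ring V, vsmall V (p%:R : Qt)%:A,
    forall c : Qt, c != 0 ->
      exists i j, vunit V (c%:A * (p%:R : Qt)%:A ^+ i / (p%:R : Qt)%:A ^+ j),
    forall c : int, V (c%:~R : Qt)%:A /\ (~~ (p %| c)%Z -> vunit V (c%:~R : Qt)%:A)
  & exists2 u, vunit V u & (tvar ^+ l - 1)%:A = (p%:R : Qt)%:A ^+ e * u].
Proof.
move=> p_pr pl; have pQ0 : p%:R != 0 :> rat by rewrite pnatr_eq0 -lt0n prime_gt0.
(* [w'] is the inverse of [w] under composition, so composing with [w'] rewrites a polynomial in [t]
   as one in [w]; [iota] below identifies integer polynomials with their values at [w]. *)
pose w : {poly rat} := p%:R ^- e *: ('X - 1); pose w' : {poly rat} := 1 + p%:R ^+ e *: 'X.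
have ww' : w' \Po w = 'X.
  rewrite /w' comp_polyD comp_polyZ comp_polyX comp_polyC /w scalerA mulfV ?expf_neq0 //.
  by rewrite scale1r addrC subrK.
have w'w : w \Po w' = 'X.
  rewrite /w comp_polyZ rmorphB /= comp_polyX comp_polyC /w' addrC addKr scalerA.
  by rewrite mulVf ?expf_neq0 // scale1r.
pose iota : {rmorphism {poly int} -> L} :=
  in_alg L \o @tofrac _ \o comp_poly w \o map_poly (intr : int -> rat).
have iota_inj : injective iota.
  apply: inj_comp (map_inj_poly (@intr_inj rat) (rmorph0 _)).
  apply: inj_comp (can_inj (g := comp_poly w') _); last first.
    by move=> x /=; rewrite -comp_polyA w'w comp_polyXr.
  apply: inj_comp (fmorph_inj _) _ => x y /eqP; rewrite tofrac_eq => /eqP //.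
pose phi : {rmorphism {poly int} -> {poly 'F_p}} := map_poly (intr : int -> 'F_p).
have iotaC (c : int) : iota c%:P = (c%:~R : Qt)%:A.
  by rewrite /= map_polyC comp_polyC /= !rmorph_int.
have phiC (c : int) : (phi c%:P == 0) = (p %| c)%Z.
  by rewrite /= map_polyC polyC_eq0 (dvdz_pcharf (pchar_Fp p_pr)).
have iotap : iota (p%:Z)%:P = (p%:R : Qt)%:A by rewrite iotaC.
have [||V [vV Viota Vphi V'p]] := @valuation_ring_over_prime _ _ L phi iota (p%:Z)%:P iota_inj.
- by rewrite polyC_eq0 eqz_nat -lt0n prime_gt0.
- by apply/eqP; rewrite phiC dvdzz.
have iota0 h : h != 0 -> iota h != 0 by rewrite -(rmorph0 iota) (inj_eq iota_inj).
have u_iota h : phi h != 0 -> vunit V (iota h).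
  move=> hp; split=> //; last exact: Vphi.
  by apply: iota0; apply: contraNneq hp => ->; rewrite rmorph0.
set P := (p%:R : Qt)%:A.
have P0 : P != 0 by rewrite /P -iotap iota0 // polyC_eq0 eqz_nat -lt0n prime_gt0.
pose fin c := exists i j, vunit V (c * P ^+ i / P ^+ j).
have fin_div x y : fin x -> fin y -> fin (x / y).
  move=> [i [j u]] [i' [j' u']]; exists (i + j')%N, (j + i')%N.
  have y0 : y != 0 by apply: contraTneq (vunit_neq0 u') => ->; rewrite !mul0r eqxx.
  have -> : x / y * P ^+ (i + j') / P ^+ (j + i') = x * P ^+ i / P ^+ j / (y * P ^+ i' / P ^+ j').
    by rewrite !exprD; field; rewrite y0 !expf_neq0.
  exact: (vunit_div vV).
have fin_iota h : h != 0 -> fin (iota h).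
  move=> /(primitive_decomposition p_pr)[i [h' [-> h'p]]]; exists 0%N, i.
  rewrite -mul_polyC polyC_exp (rmorphM iota) (rmorphXn iota) iotap -/P.
  by rewrite expr0 mulr1 mulrC mulKf ?expf_neq0 //; apply: u_iota.
have fin_poly (x : {poly rat}) : x != 0 -> fin (tofrac x)%:A.
  move=> x0; have [q [a a0 qE]] := rat_poly_scale (x \Po w').
  have a0' : a%:~R != 0 :> rat by rewrite intr_eq0.
  have -> : (tofrac x)%:A = iota q / iota a%:P.
    apply: (canRL (mulfK _)); first by rewrite iota0 // polyC_eq0.
    rewrite -[x]comp_polyXr -ww' comp_polyA qE comp_polyZ -mul_polyC.
    rewrite /= map_polyC /= comp_polyC -!(rmorphM (in_alg L)) -tofracM mulrAC -polyCM.
    by rewrite mulVf // mul1r.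
  apply: fin_div; apply: fin_iota; last by rewrite polyC_eq0.
  apply: contraNneq x0 => q0; rewrite -[x]comp_polyXr -ww' comp_polyA qE q0.
  by rewrite rmorph0 scaler0 comp_poly0.
exists V; split => //.
- by right; rewrite /P -iotap.
- move=> c c0; have [n [d [d0 cE]]] := fraction_repr c.
  have n0 : n != 0 by apply: contraNneq c0 => n0; rewrite cE n0 rmorph0 mul0r.
  have -> : c%:A = (tofrac n)%:A / (tofrac d)%:A :> L by rewrite cE; exact: (fmorph_div (in_alg L)).
  exact: fin_div (fin_poly _ n0) (fin_poly _ d0).
- move=> c; rewrite -iotaC; split; first exact: Viota.
  by rewrite -phiC; apply: u_iota.
(* [t ^ l - 1] is [p ^ e * w] times the sum of the [t ^ j] for [j < l]. That sum is nonzero modulo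
   [p] because it equals [l] at [w = 0], an argument that covers [e = 0] as well. *)
pose h : {poly int} := 'X * \sum_(j < l) (1 + (p%:Z ^+ e)%:P * 'X) ^+ j.
exists (iota h).
  apply: u_iota; rewrite rmorphM /= map_polyX mulf_neq0 ?polyX_eq0 //.
  have : (\sum_(j < l) (1 + (p%:Z ^+ e)%:P * 'X) ^+ j : {poly int}).[0] = l%:Z.
    rewrite horner_sum (eq_bigr (fun _ => 1)); first by rewrite sumr_const card_ord natz.
    by move=> j _; rewrite !hornerE ?mulr0 ?addr0 expr1n.
  set s := \sum_(j < l) _ => s0; apply: contraNneq pl => sp0.
  have : (p %| l%:Z)%Z; last by [].
  rewrite (dvdz_pcharf (pchar_Fp p_pr)) -s0 -(horner_map (intr : int -> 'F_p)) /=.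
  by rewrite sp0 horner0.
set g : {poly int} := 1 + (p%:Z ^+ e)%:P * 'X in h *.
have gE : iota g = tvar%:A.
  rewrite /= /g rmorphD rmorph1 rmorphM /= map_polyX map_polyC /= rmorphXn /=.
  by rewrite mul_polyC -[p%:~R]/(p%:R) -/w' ww'.
have hE : (p%:Z)%:P ^+ e * h = g ^+ l - 1.
  by rewrite subrX1 /h mulrA -polyC_exp /g [1 + _]addrC addrK.
have -> : (tvar ^+ l - 1)%:A = iota g ^+ l - 1.
  by rewrite gE; have := rmorphB (in_alg L) (tvar ^+ l) 1; rewrite rmorphXn rmorph1 => <-.
by rewrite -(rmorphXn iota) -(rmorph1 iota) -(rmorphB iota) -hE (rmorphM iota) (rmorphXn iota) iotap.
Qed.

(** * The family of polynomials *)

Lemma map_linear_factorsB1 (R S : comNzRingType) (f : {rmorphism R -> S}) (m : nat)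
    (a : 'I_m -> R) (b : R) :
  map_poly f (\prod_(i < m) ('X - (a i)%:P) * ('X - b%:P) - 1)
  = \prod_(i < m) ('X - (f (a i))%:P) * ('X - (f b)%:P) - 1.
Proof.
have fX c : map_poly f ('X - c%:P) = 'X - (f c)%:P by rewrite rmorphB /= map_polyX map_polyC.
by rewrite rmorphB rmorph1 rmorphM rmorph_prod /= fX; under eq_bigr do rewrite fX.
Qed.

Lemma Qt_nat_neq0 (n : nat) : (0 < n)%N -> n%:R != 0 :> Qt.
Proof.
move=> n0; rewrite -(rmorph_nat (@tofrac _ \o polyC)) /= tofrac_eq0 polyC_eq0.
by rewrite pnatr_eq0 -lt0n.
Qed.

Lemma logn_prod (I : finType) (p : nat) (F : I -> nat) : (forall i, 0 < F i)%N ->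
  logn p (\prod_i F i) = (\sum_i logn p (F i))%N.
Proof.
move=> F0; suff [_ ->] : (0 < \prod_i F i)%N /\ logn p (\prod_i F i) = (\sum_i logn p (F i))%N by [].
apply: (big_ind2 (fun x y => (0 < x)%N /\ logn p x = y)) => [|x y x' y' [x0 <-] [x'0 <-]|i _].
- by rewrite logn1.
- by rewrite muln_gt0 x0 x'0 lognM.
- by rewrite F0.
Qed.

Lemma monic_linear_factorsB1 (R : idomainType) (m : nat) (a : 'I_m -> R) (b : R) :
  let f := \prod_(i < m) ('X - (a i)%:P) * ('X - b%:P) - 1 in f \is monic /\ size f = m.+2.
Proof.
set g := \prod_(i < m) _ * _; have mg : g \is monic by rewrite monicMl ?monicXsubC ?monic_prod_XsubC.
have sg : size g = m.+2.
  rewrite size_Mmonic ?monicXsubC ?monic_neq0 ?monic_prod_XsubC //.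
  by rewrite size_XsubC size_prod_XsubC addn2 /= /index_enum -enumT size_enum_ord.
have lt1 : (size (-1 : {poly R})%R < size g)%N by rewrite size_polyN size_poly1 sg.
by rewrite /= monicE lead_coefDl // size_polyDl // -monicE.
Qed.

Section Family.
Variables (m l : nat) (alpha : 'I_m -> nat).
Hypothesis alpha_gt0 : forall i, (0 < alpha i)%N.

Definition cluster (p : nat) : {set 'I_m} := [set i | p %| alpha i]%N.

(* The condition on p in the header, with k = #|cluster p|. *)
Definition tame (p : nat) : Prop :=
  (forall i, logn p (alpha i) = (p %| alpha i)%N) /\
  (forall i j, i != j -> i \notin cluster p -> alpha i != alpha j %[mod p]%N).

(* The zeros a_i and b of f + 1. *)
Definition azero (i : 'I_m) : int := (alpha i)%:Z.
Definition bzero : Qt := (-1) ^+ m * (tvar ^+ l - 1) / (\prod_(i < m) azero i)%:~R.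

Lemma logn_tame p : tame p -> logn p (\prod_i alpha i) = #|cluster p|.
Proof.
move=> [logE _]; rewrite logn_prod // -sum1_card [RHS]big_mkcond /=; apply: eq_bigr => i _.
by rewrite logE inE; case: (_ %| _)%N.
Qed.

Lemma tame_diff p i j : tame p -> i != j -> i \notin cluster p \/ j \notin cluster p ->
  ~~ (p %| azero i - azero j)%Z.
Proof.
move=> [_ tp] ij ijD; rewrite -eqz_mod_dvd !modz_nat eqz_nat.
by case: ijD => [iD|jD]; [|rewrite eq_sym]; apply: tp; rewrite // eq_sym.
Qed.

Lemma tame_diff1 p i j : tame p -> #|cluster p| = 1%N -> i != j -> ~~ (p %| azero i - azero j)%Z.
Proof.
move=> tp k1 ij; apply: tame_diff => //; have [iD|] := boolP (i \in cluster p); last by left.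
right; apply: contraTN isT => jD; have := cards2 i j; rewrite ij => c2.
have : (#|[set i; j]| <= #|cluster p|)%N.
  by apply: subset_leq_card; rewrite subUset !sub1set iD jD.
by rewrite c2 k1.
Qed.

Lemma prod_azero : \prod_(i < m) azero i = (\prod_i alpha i)%:Z.
Proof. by rewrite (big_morph Posz PoszM (erefl _)). Qed.

(** In lowest terms [c = u / v], clearing denominators turns the right side into [v ^+ m.+1]. Each
    [u - a_i v] is prime to [v] and divides this power, hence is constant; two distinct [a_i] make
    [v] and [u] constant. Then [beta * v] is constant too, although [beta] has degree [l > 0] in
    [t]. *)
Lemma no_rational_root (c : Qt) : (1 < m)%N -> (0 < l)%N -> injective alpha ->
  \prod_(i < m) (c - (azero i)%:~R) * (c - bzero) != 1.
Proof.
move=> m1 l0 inj_alpha; apply/eqP.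
have [n [d [d0 ->]]] := fraction_repr c.
have [u [v [v0 uv ->]]] : exists u v : {poly rat},
    [/\ v != 0, coprimep u v & tofrac n / tofrac d = tofrac u / tofrac v].
  have g0 : gcdp n d != 0 by rewrite gcdp_eq0 negb_and d0 orbT.
  exists (n %/ gcdp n d), (d %/ gcdp n d); split.
  - by apply: contraNneq d0 => dg; rewrite -(divpK (dvdp_gcdr n d)) dg mul0r.
  - by apply: coprimep_div_gcd; rewrite d0 orbT.
  - have -> : tofrac n = tofrac (n %/ gcdp n d) * tofrac (gcdp n d).
      by rewrite -tofracM divpK // dvdp_gcdl.
    have -> : tofrac d = tofrac (d %/ gcdp n d) * tofrac (gcdp n d).
      by rewrite -tofracM divpK // dvdp_gcdr.
    by rewrite invfM mulrACA mulfV ?mulr1 // tofrac_eq0.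
pose cst : rat := (-1) ^+ m / (\prod_(i < m) azero i)%:~R.
have A0 : (\prod_(i < m) azero i)%:~R != 0 :> rat.
  by rewrite intr_eq0; apply/prodf_neq0 => i _; rewrite eqz_nat -lt0n.
have cst0 : cst != 0 by rewrite mulf_neq0 ?invr_eq0 // expf_neq0 ?oppr_eq0 ?oner_eq0.
pose beta : {poly rat} := cst *: ('X^l - 1).
have betaE : bzero = tofrac beta.
  rewrite /beta -mul_polyC /bzero rmorphM /= rmorphB rmorphXn rmorph1 /= /cst.
  have -> : tofrac (((-1) ^+ m / (\prod_(i < m) azero i)%:~R)%:P : {poly rat})
      = (-1) ^+ m / (\prod_(i < m) azero i)%:~R.
    apply: (canRL (mulfK _)).
      by rewrite -(rmorph_int (@tofrac _ \o polyC)) /= tofrac_eq0 polyC_eq0.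
    rewrite -(rmorph_int (@tofrac _ \o polyC)) /= -tofracM -polyCM divfK //.
    by rewrite -[LHS]/((@tofrac _ \o polyC) _) rmorphXn rmorphN1.
  by rewrite mulrAC.
move/(congr1 (fun x => x * tofrac v ^+ m.+1)); rewrite mul1r.
have V0 : tofrac v != 0 by rewrite tofrac_eq0.
have -> : \prod_(i < m) (tofrac u / tofrac v - (azero i)%:~R) * (tofrac u / tofrac v - bzero) * tofrac v ^+ m.+1
   = tofrac (\prod_(i < m) (u - (azero i)%:~R * v) * (u - beta * v)).
  rewrite exprSr mulrACA rmorphM rmorph_prod /=; congr (_ * _).
    rewrite -[m in _ ^+ m]card_ord -prodr_const -big_split /=; apply: eq_bigr => i _.
    by rewrite mulrBl divfK // tofracB tofracM rmorph_int.
  by rewrite mulrBl divfK // betaE tofracB tofracM.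
rewrite -tofracXn => /eqP; rewrite tofrac_eq => /eqP E.
have dvd_pow x : x %| \prod_(i < m) (u - (azero i)%:~R * v) * (u - beta * v) -> x %| v ^+ m.+1.
  by rewrite E.
have sz1 i : size (u - (azero i)%:~R * v) = 1%N.
  apply/eqP; rewrite size_poly_eq1; apply: (@coprimepP _ _ (v ^+ m.+1) _); last first.
  - by apply: dvd_pow; rewrite (bigD1 i) //= -mulrA dvdp_mulr.
  - exact: dvdpp.
  - by apply: coprimep_expr; rewrite coprimep_sym -mulNr addrC coprimep_addl_mul coprimep_sym.
have szB (x y : {poly rat}) : (size x <= 1)%N -> (size y <= 1)%N -> (size (x - y)%R <= 1)%N.
  by move=> sx sy; rewrite (leq_trans (size_polyD _ _)) // size_polyN geq_max sx sy.
pose i0 := Ordinal (ltnW m1); pose i1 := Ordinal m1.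
have a01 : (azero i1 - azero i0)%:~R != 0 :> rat.
  by rewrite intr_eq0 subr_eq0 eqz_nat (inj_eq inj_alpha).
have sv : size v = 1%N.
  apply/eqP; rewrite eqn_leq size_poly_gt0 v0 andbT.
  have : (size ((u - (azero i0)%:~R * v) - (u - (azero i1)%:~R * v))%R <= 1)%N by apply: szB; rewrite sz1.
  have -> : u - (azero i0)%:~R * v - (u - (azero i1)%:~R * v) = (azero i1 - azero i0)%:~R *: v.
    by rewrite -mul_polyC rmorph_int rmorphB /=; ring.
  by rewrite size_scale.
have su : (size u <= 1)%N.
  have -> : u = (u - (azero i0)%:~R * v) - (- (azero i0))%:~R *: v.
    by rewrite -mul_polyC rmorph_int rmorphN /=; ring.
  by apply: szB; rewrite ?sz1 // (leq_trans (size_scale_leq _ _)) ?sv.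
have sbv : (size (beta * v)%R <= 1)%N.
  have -> : beta * v = u - (u - beta * v) by ring.
  apply: szB => //; have v_unit : v ^+ m.+1 != 0 by rewrite expf_neq0.
  have : u - beta * v %| v ^+ m.+1 by apply: dvd_pow; rewrite dvdp_mull.
  move/(dvdp_leq v_unit)/leq_trans; apply.
  by rewrite (leq_trans (size_exp_leq _ _)) // sv mul0n.
have sb : size beta = l.+1 by rewrite size_scale // size_XnsubC.
have b0 : beta != 0 by rewrite -size_poly_eq0 sb.
by move: sbv; rewrite size_mul // sb sv addn1 /= ltnS leqNgt l0.
Qed.


Lemma tame_valuation (p : nat) (L : fieldExtType Qt) : prime p -> ~~ (p %| l)%N ->
  tame p -> (0 < #|cluster p|)%N ->
  exists V : L -> Prop, [/\ is_valuation_ring V, vsmall V (p%:R : Qt)%:A,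
    forall c : Qt, c != 0 ->
      exists i j, vunit V (c%:A * (p%:R : Qt)%:A ^+ i / (p%:R : Qt)%:A ^+ j),
    forall c : int, V (c%:~R : Qt)%:A /\ (~~ (p %| c)%Z -> vunit V (c%:~R : Qt)%:A)
  & vunit V ((p%:R : Qt)%:A * bzero%:A)].
Proof.
move=> p_pr pl tp k0.
have [V [vV sp VK Vint [u uu tE]]] := gauss_valuation #|cluster p|.-1 L p_pr pl.
exists V; split=> //.
have A0 : (0 < \prod_i alpha i)%N by apply: prodn_gt0.
have [A' pA' AE] := pfactor_coprime p_pr A0.
rewrite logn_tame // -(prednK k0) in AE; set e := _.-1 in AE tE.
have uA' : vunit V (A'%:~R : Qt)%:A.
  by apply: (Vint A'%:Z).2; rewrite -prime_coprime.
have A'0 := vunit_neq0 uA'; set P := (p%:R : Qt)%:A in sp VK tE *.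
have P0 : P != 0 by rewrite scaler_eq0 oner_eq0 orbF Qt_nat_neq0 ?prime_gt0.
have bE : bzero%:A = (-1) ^+ m * (tvar ^+ l - 1)%:A / ((A'%:~R : Qt)%:A * P ^+ e.+1).
  have -> : bzero%:A = in_alg L ((-1) ^+ m * (tvar ^+ l - 1) / (A'%:R * p%:R ^+ e.+1)).
    by rewrite /bzero prod_azero AE -pmulrn natrM natrX.
  rewrite fmorph_div (rmorphM (in_alg L) ((-1) ^+ m)) (rmorphXn (in_alg L) m).
  by rewrite rmorphN1 (rmorphM (in_alg L) A'%:R) (rmorphXn (in_alg L) e.+1).
have cancel (F : fieldType) (x y s v : F) :
    x != 0 -> y != 0 -> x * (s * (x ^+ e * v) / (y * x ^+ e.+1)) = s * v / y.
  by move=> x0 y0; rewrite exprS; field; rewrite x0 y0 expf_neq0.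
have -> : P * bzero%:A = (-1) ^+ m * u / (A'%:~R : Qt)%:A.
  by rewrite bE tE cancel.
apply: (vunit_div vV) => //; apply: (vunitM vV) => //; apply: (vunitX vV).
by apply: (vunitN vV); apply: vunit1.
Qed.

Section SplittingField.
Variables (L : splittingFieldType Qt) (rs : seq L).
Hypothesis rsE : map_poly (in_alg L) (f_tx (n := m.+1) l azero) = \prod_(r <- rs) ('X - r%:P).

Lemma map_f_tx : \prod_(i < m) ('X - (((azero i)%:~R : Qt)%:A)%:P) * ('X - (bzero%:A)%:P) - 1
  = \prod_(r <- rs) ('X - r%:P).
Proof.
by rewrite -rsE; apply/esym; exact: (map_linear_factorsB1 (in_alg L)).
Qed.

(** A one-element cluster makes the [a_i] pairwise distinct modulo [p], so each attracts its own
    root and the root outside [V] completes the count. Members of a larger cluster would not be told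
    apart. *)
Lemma tame_uniq_roots p : prime p -> ~~ (p %| l)%N -> tame p -> #|cluster p| = 1%N -> uniq rs.
Proof.
move=> p_pr pl tp k1; have k0 : (0 < #|cluster p|)%N by rewrite k1.
have [V [vV sp VK Vint ub]] := tame_valuation L p_pr pl tp k0.
apply: (uniq_roots vV _ _ map_f_tx) => [i|Vb|i j ij]; first by case: (Vint (azero i)).
  by apply: (vunit_not_small ub); apply: vsmallM.
have -> : ((azero i)%:~R : Qt)%:A - ((azero j)%:~R : Qt)%:A = ((azero i - azero j)%:~R : Qt)%:A :> L.
  by rewrite rmorphB scalerBl.
exact/(Vint _).2/tame_diff1.
Qed.

Lemma tame_cluster_transitive p : prime p -> ~~ (p %| l)%N -> tame p -> (1 < #|cluster p|)%N ->
  uniq rs -> galois 1 {:L} -> exists C : seq L,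
  [/\ uniq C, size C = #|cluster p|, {subset C <= rs} &
   forall x y, x \in C -> y \in C -> exists2 g, g \in 'Gal({:L} / 1)%g &
     g x = y /\ forall z, z \in rs -> z \notin C -> g z = z].
Proof.
move=> p_pr pl tp k1 uniq_rs galL.
have [V [vV sp VK Vint ub]] := tame_valuation L p_pr pl tp (ltnW k1).
have p0 : p%:R != 0 :> Qt by rewrite Qt_nat_neq0 ?prime_gt0.
have pA0 : (p%:R : Qt)%:A != 0 :> L by rewrite scaler_eq0 oner_eq0 orbF.
apply: (cluster_transitive vV p0 sp VK k1 ub _ _ _ map_f_tx) => //.
- move=> i; rewrite inE => /dvdnP[c aE].
  have -> : ((azero i)%:~R : Qt)%:A / (p%:R : Qt)%:A = (c%:Z%:~R : Qt)%:A :> L.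
    apply: (canLR (mulfK pA0)); rewrite /azero aE mulr_algl scalerA.
    by rewrite -[X in _ = X *: _]natrM.
  by case: (Vint c).
- move=> i iD; apply: (Vint _).2; by rewrite inE in iD.
- move=> i j iD jD ij.
  have -> : ((azero i)%:~R : Qt)%:A - ((azero j)%:~R : Qt)%:A = ((azero i - azero j)%:~R : Qt)%:A :> L.
    by rewrite rmorphB scalerBl.
  by apply: (Vint _).2; apply: tame_diff => //; left.
Qed.

End SplittingField.

(** At [t = 0] the numerator [t ^ l - 1] is [-1], so [b] has exactly one [p] in its denominator, and
    the count of separated roots applies to a valuation ring of [algC] extending the [p]-adic one of
    the integers. *)
Lemma tame_separable_f_0x p : prime p -> (0 < l)%N -> tame p -> #|cluster p| = 1%N ->
  separable_poly (f_0x (n := m.+1) l azero).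
Proof.
move=> p_pr l0 tp k1; rewrite -(separable_map (ratr : rat -> algC)) /f_0x map_linear_factorsB1 /=.
set b := ratr (_ / _); have [mf _] := monic_linear_factorsB1 (fun i => ratr (azero i)%:~R : algC) b.
have [rs] := closed_field_poly_normal (\prod_(i < m) ('X - (ratr (azero i)%:~R : algC)%:P) * ('X - b%:P) - 1).
rewrite (monicP mf) scale1r => rsE; rewrite rsE separable_prod_XsubC.
pose phi : {rmorphism int -> 'F_p} := intr; pose iota : {rmorphism int -> algC} := intr.
have p0 : p%:Z != 0 by rewrite eqz_nat -lt0n prime_gt0.
have phiE c : (phi c == 0) = (p %| c)%Z by rewrite (dvdz_pcharf (pchar_Fp p_pr)).
have [|V [vV Viota Vphi V'p]] := @valuation_ring_over_prime _ _ _ phi iota p%:Z (@intr_inj algC) p0.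
  by apply/eqP; rewrite phiE dvdzz.
apply: (uniq_roots vV _ _ rsE) => [i|Vb|i j ij]; first by rewrite ratr_int; apply: Viota.
  apply: V'p; have A0 : (0 < \prod_i alpha i)%N by apply: prodn_gt0.
  have [A' pA' AE] := pfactor_coprime p_pr A0; rewrite logn_tame // k1 expn1 in AE.
  have A'0 : A'%:R != 0 :> algC by move: A0; rewrite AE muln_gt0 pnatr_eq0 -lt0n => /andP[].
  have bE : b = (-1) ^+ m.+1 / (A'%:R * p%:R).
    rewrite /b fmorph_div rmorphM rmorphXn rmorphN1 rmorphB rmorph1 rmorphXn rmorph0 expr0n.
    by rewrite (gtn_eqF l0) sub0r rmorph_int prod_azero AE -pmulrn natrM mulrN1 exprS mulN1r.
  have -> : (iota p%:Z)^-1 = (-1) ^+ m.+1 * b * iota A'%:Z.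
    rewrite bE /iota /= -!pmulrn [LHS]/= mulrA -exprD addnn -mul2n exprM sqrrN expr1n expr1n.
    by field; rewrite A'0 pnatr_eq0 -lt0n prime_gt0.
  apply: (subringM vV); last exact: Viota.
  by apply: (subringM vV) => //; apply: (subringX vV); apply/(subringN vV)/(subring1 vV).
have dij : phi (azero i - azero j) != 0.
  by rewrite phiE; apply: tame_diff1.
rewrite !ratr_int -rmorphB; split; [|exact: Viota|exact: Vphi].
by rewrite intr_eq0; apply: contraNneq dij => ->; rewrite rmorph0.
Qed.

End Family.

Lemma rmorph_factors (R S : comNzRingType) (f : {rmorphism R -> S}) (I : finType)
    (a : I -> R) (b c : R) :
  f (\prod_i (c - a i) * (c - b)) = \prod_i (f c - f (a i)) * (f c - f b).
Proof. by rewrite rmorphM rmorph_prod rmorphB; under eq_bigr do rewrite rmorphB. Qed.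

(** The values are [p q o], [2 p q], [3 p], ..., [m p]. As [p > m + l], it divides neither [l] nor
    any [i + 1]. The larger prime [q] divides the first two values only, and the others are distinct
    modulo [q] since [i + 1 < q]. Finally [o > 2 p q], so all values but the first are below [o] and
    are their own residues. *)
Lemma exists_tame (m l : nat) : (1 < m)%N -> (0 < l)%N ->
  exists (alpha : 'I_m -> nat) (p q o : nat),
  [/\ forall i, (0 < alpha i)%N, [/\ prime p, prime q & prime o],
      [/\ ~~ (p %| l)%N, ~~ (q %| l)%N & ~~ (o %| l)%N],
      [/\ tame alpha p, tame alpha q & tame alpha o]
    & [/\ #|cluster alpha p| = m, #|cluster alpha q| = 2 & #|cluster alpha o| = 1%N]].
Proof.
move=> m1 l0; have [p ltp p_pr] := prime_above (m + l).
have [q ltq q_pr] := prime_above p; have [o lto o_pr] := prime_above (p * (2 * q)).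
have p0 := prime_gt0 p_pr; have q0 := prime_gt0 q_pr; have o0 := prime_gt0 o_pr.
have pqo : (p < q < o)%N by rewrite ltq; nia.
have /andP[_ qo] := pqo; have po := ltn_trans ltq qo.
pose c (i : 'I_m) := ((if i < 2 then q else 1) * (if i == 0 :> nat then o else 1))%N.
pose alpha (i : 'I_m) := (p * (i.+1 * c i))%N.
have c0 i : (0 < c i)%N by rewrite /c; case: ifP; case: ifP; rewrite ?mul1n ?muln1 ?muln_gt0 ?q0 ?o0.
have alpha0 i : (0 < alpha i)%N by rewrite /alpha muln_gt0 p0 muln_gt0 c0.
have logE r i : prime r -> (m < r)%N ->
    logn r (alpha i) = ((r == p) + ((i < 2) * (r == q) + (i == 0 :> nat) * (r == o)))%N.
  have ic0 : (0 < i.+1 * c i)%N by rewrite muln_gt0 c0.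
  move=> r_pr mr; rewrite /alpha lognM // logn_prime //; congr (_ + _)%N.
  rewrite lognM // ltn_log0 ?add0n; last by rewrite (leq_ltn_trans _ mr).
  rewrite /c lognM; [|by case: ifP|by case: ifP].
  by congr (_ + _)%N; case: ifP => _; rewrite ?logn1 ?logn_prime // mul1n.
have [mp mq mo] : [/\ m < p, m < q & m < o]%N by split; lia.
have [qp op oq] : [/\ q == p = false, o == p = false & o == q = false] by split; apply/eqP; lia.
have [pq po' qo'] : [/\ p == q = false, p == o = false & q == o = false] by split; apply/eqP; lia.
have logp i : logn p (alpha i) = 1%N by rewrite logE // eqxx pq po' !muln0.
have logq i : logn q (alpha i) = (i < 2)%N by rewrite logE // eqxx qp qo' muln0 muln1 addn0.
have logo i : logn o (alpha i) = (i == 0 :> nat) by rewrite logE // eqxx op oq muln0 muln1.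
have dvdE r i : prime r -> (r %| alpha i)%N = (0 < logn r (alpha i))%N.
  by move=> r_pr; rewrite -[r in LHS]expn1 pfactor_dvdn.
have dvdq i : (q %| alpha i)%N = (i < 2)%N by rewrite dvdE // logq; case: (i < 2)%N.
have dvdo i : (o %| alpha i)%N = (i == 0 :> nat) by rewrite dvdE // logo; case: (_ == _).
have alphaE (i : 'I_m) : (1 < i)%N -> alpha i = (p * i.+1)%N.
  by case: i => [[|[|i]] im] //= _; rewrite /alpha /c /= !muln1.
have lt_alpha (i : 'I_m) : (0 < i)%N -> (alpha i < o)%N.
  case: i => [[|[|i]] im] //= _; first by rewrite /alpha /c /= muln1.
  by rewrite alphaE //=; apply: leq_ltn_trans lto; rewrite leq_mul2l; apply/orP; right; lia.
have alpha_inj (i j : 'I_m) : (0 < i)%N -> (0 < j)%N -> alpha i = alpha j -> i = j.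
  move=> i0 j0 E; apply: val_inj; move: E i0 j0; case: i j => [[|[|i]] im] [[|[|j]] jm] //=;
    rewrite /alpha /c //= ?muln1 => /eqP; rewrite eqn_pmul2l // => /eqP; lia.
have ltnl r : (l < r)%N -> ~~ (r %| l)%N by move=> lr; apply: contraL lr => /dvdn_leq; rewrite -leqNgt; apply.
exists alpha, p, q, o; split => //.
- by split; apply: ltnl; lia.
- split; split => [i|i j ij].
  + by rewrite dvdE // logp.
  + by rewrite inE dvdE // logp.
  + by rewrite dvdq logq.
  + rewrite inE dvdq -leqNgt => i2.
    have [j2|j2] := ltnP j 2.
      have /eqP -> : (alpha j %% q == 0)%N by rewrite -/(dvdn q _) dvdq j2.
      by rewrite -/(dvdn q _) dvdq ltnNge i2.
    wlog ltij : i j ij i2 j2 / (i < j)%N => [hw|].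
      case: (ltngtP i j) => [lt|lt|/val_inj E]; [exact: hw|rewrite eq_sym; apply: hw => //|].
        by rewrite eq_sym.
      by rewrite E eqxx in ij.
    (* The difference is [p * (j - i)] with [0 < j - i < q]. *)
    rewrite eq_sym eqn_mod_dvd; last by rewrite !alphaE // leq_mul2l ltnS ltnW ?orbT.
    rewrite !alphaE // -mulnBr Euclid_dvdM // negb_or subSS; apply/andP; split.
      by rewrite dvdn_prime2 // qp.
    apply/negP => /dvdn_leq; rewrite subn_gt0 => /(_ ltij); have := ltn_ord j; lia.
  + by rewrite dvdo logo.
  + rewrite inE dvdo -lt0n => i0; have [j0|j0] := posnP j.
      have /eqP -> : (alpha j %% o == 0)%N by rewrite -/(dvdn o _) dvdo j0.
      by rewrite -/(dvdn o _) dvdo -lt0n.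
    by rewrite !modn_small ?lt_alpha //; apply: contraNneq ij => /alpha_inj ->.
- have card_lt k : (k <= m)%N -> #|[set i : 'I_m | i < k]%N| = k.
    move=> km; rewrite -sum1_card -[RHS]card_ord -sum1_card.
    rewrite (big_ord_widen_cond m xpredT (fun _ => 1%N) km).
    by apply: eq_bigl => i; rewrite inE.
  split.
  + by rewrite -[RHS]card_ord -cardsT; apply: eq_card => i; rewrite !inE dvdE // logp.
  + by rewrite -[RHS](card_lt _ m1); apply: eq_card => i; rewrite !inE dvdq.
  + by rewrite -[RHS](card_lt _ (ltnW m1)); apply: eq_card => i; rewrite !inE dvdo ltnS leqn0.
Qed.

Theorem theorem5p1 (n l : nat) (hn : (3 <= n)%N) (hl : (1 <= l)%N) :
  exists a : 'I_n.-1 -> int,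
    [/\ injective a,
        (forall i, a i != 0),
        galois_group_is_Sn (f_tx l a)
      & separable_poly (f_0x l a)].
Proof.
case: n hn => // m; rewrite ltnS /= => m1.
have [alpha [p [q [o [alpha0 [p_pr q_pr o_pr] [pl ql ol] [tp tq to] [cp cq co]]]]]] :=
  exists_tame m1 hl.
have a_inj : injective (azero alpha).
  move=> i j aij; apply/eqP/negPn/negP => ij.
  by have := tame_diff1 to co ij; rewrite aij subrr dvdz0.
have alpha_inj : injective alpha by move=> i j aij; apply: a_inj; rewrite /azero aij.
exists (azero alpha); split=> //.
- by move=> i; rewrite eqz_nat -lt0n.
- have [mf szf] := monic_linear_factorsB1 (fun i => (azero alpha i)%:~R : Qt) (bzero l alpha).
  have [L [rs [rsE rsF]]] := exists_splitting_field mf.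
  have rsE' := map_f_tx rsE; have szrs := size_roots rsE'.
  have uniq_rs := tame_uniq_roots alpha0 rsE o_pr ol to co.
  have galL : galois 1 {:L}.
    apply/splitting_galoisField; exists (map_poly (in_alg L) (f_tx (n := m.+1) l (azero alpha))); split.
    + by apply/polyOver1P; exists (f_tx (n := m.+1) l (azero alpha)).
    + by rewrite rsE separable_prod_XsubC.
    + by exists rs; rewrite ?rsE ?eqpxx.
  have [C1 [uC1 szC1 sC1 trC1]] : exists C1 : seq L, [/\ uniq C1, size C1 = #|cluster alpha p|,
      {subset C1 <= rs} & forall x y, x \in C1 -> y \in C1 -> exists2 g, g \in 'Gal({:L} / 1)%g &
      g x = y /\ forall z, z \in rs -> z \notin C1 -> g z = z].
    by apply: (tame_cluster_transitive alpha0 rsE p_pr pl tp _ uniq_rs galL); rewrite cp.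
  have [C2 [uC2 szC2 sC2 trC2]] : exists C2 : seq L, [/\ uniq C2, size C2 = #|cluster alpha q|,
      {subset C2 <= rs} & forall x y, x \in C2 -> y \in C2 -> exists2 g, g \in 'Gal({:L} / 1)%g &
      g x = y /\ forall z, z \in rs -> z \notin C2 -> g z = z].
    by apply: (tame_cluster_transitive alpha0 rsE q_pr ql tq _ uniq_rs galL); rewrite cq.
  (* A root fixed by the whole group would lie in Q(t), against [no_rational_root]. *)
  have moved r : r \in rs -> exists2 g, g \in 'Gal({:L} / 1)%g & g r != r.
    move=> r_rs; apply: contrapT => nex.
    have : r \in fixedField 'Gal({:L} / 1)%g.
      apply/fixedFieldP => [|g gG]; first exact: memvf.
      by apply/eqP/negPn/negP => gr; apply: nex; exists g.
    have /galois_fixedField -> := galL; case/vlineP => c rE.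
    have /eqP[] := no_rational_root alpha0 c m1 hl alpha_inj; apply: (fmorph_inj (in_alg L)).
    rewrite rmorph_factors rmorph1; apply/eqP.
    by move: r_rs; rewrite (mem_roots rsE') rE.
  exists L, rs; split=> //.
  + by rewrite (monicP mf) rmorph1 mul1r.
  + by rewrite szf.
  + apply: (gal_permutations uniq_rs _ moved uC1 sC1 _ trC1 uC2 sC2 _ trC2) => [g r||].
    * exact: (gal_roots rsE').
    * by rewrite szC1 cp.
    * by rewrite szC2.
- exact: (tame_separable_f_0x alpha0 o_pr hl to co).
Qed.
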